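(* Let $T\in\mathcal{D}'_{L^\infty}$. The following statements are equivalent: 1. $T\ast\varphi\in\mathcal{C}_{aa}$ for all $\varphi\in\mathcal{D}$. 2. There exist $k\in\mathbb{Z}_+$ and functions $f_0,\dots,f_k\in\mathcal{C}_{aa}$ such that $T=\sum_{j=0}^{k} f_j^{(j)}$, the derivatives being taken in the sense of distributions.
   Context: All functions and distributions are complex-valued and defined on $\mathbb{R}$; $\mathcal{D}$ is the space of smooth compactly supported functions and $\mathcal{D}'$ the space of distributions. A continuous function $f:\mathbb{R}\to\mathbb{C}$ is almost automorphic if for every real sequence $(s_m)_{m\in\mathbb{N}}$ there is a subsequence $(s_{m_k})_k$ such that $g(x):=\lim_{k\to+\infty}f(x+s_{m_k})$ is well-defined for every $x\in\mathbb{R}$ and $\lim_{k\to+\infty}g(x-s_{m_k})=f(x)$ for every $x\in\mathbb{R}$. $\mathcal{C}_{aa}$ denotes the space of almost automorphic functions. $\mathcal{D}_{L^1}=\{\varphi\in\mathcal{C}^\infty:\ \varphi^{(i)}\in L^1\ \forall i\in\mathbb{Z}_+\}$ is a Fréchet space for the norms $|\varphi|_{m,1}=\sum_{i=0}^m\|\varphi^{(i)}\|_{L^1}$, $m\in\mathbb{Z}_+$, and $\mathcal{D}$ is dense in it. $\mathcal{D}'_{L^\infty}$ is the topological dual of $\mathcal{D}_{L^1}$, regarded as a subspace of $\mathcal{D}'$; its elements are called bounded distributions. For $\varphi\in\mathcal{D}$, $(T\ast\varphi)(x)=\langle T,\varphi(x-\cdot)\rangle$. *)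

(* Defs.v *)
From HB Require Import structures.
From mathcomp Require Import all_boot all_order all_algebra.
From mathcomp Require Import complex.
From mathcomp Require Import all_classical all_reals all_analysis.

Set Implicit Arguments.
Unset Strict Implicit.
Unset Printing Implicit Defensive.

Import Order.TTheory GRing.Theory Num.Theory.
Import numFieldNormedType.Exports.

Local Open Scope classical_set_scope.
Local Open Scope ring_scope.
Local Open Scope complex_scope.

(* The topology of the complex plane is carried by the alias [R[i]^o] of [R[i]],
   hence the casts below.  Derivatives and integrals of complex-valued functions
   are taken on real and imaginary parts; [normc] is the R-valued modulus. *)

Section Distributions.
Context {R : realType}.
Implicit Types (f g phi psi : R -> R[i]) (T S : (R -> R[i]) -> R[i]).

Local Notation mu := (@lebesgue_measure R).
Local Notation normc := ComplexField.Normc.normc.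

Definition cderive f : R -> R[i] := fun x =>
  derive1 (fun t : R => complex.Re (f t)) x +i*
  derive1 (fun t : R => complex.Im (f t)) x.

Definition cderiven (n : nat) f : R -> R[i] := iter n cderive f.

Definition cderivable f (x : R) : Prop :=
  derivable (fun t : R => complex.Re (f t)) x 1 /\
  derivable (fun t : R => complex.Im (f t)) x 1.

Definition cintegrable f : Prop :=
  mu.-integrable setT (fun x => (complex.Re (f x))%:E) /\
  mu.-integrable setT (fun x => (complex.Im (f x))%:E).

Definition cintegral f : R[i] :=
  (\int[mu]_x complex.Re (f x)) +i* (\int[mu]_x complex.Im (f x)).

Definition smooth f : Prop := forall n x, cderivable (cderiven n f) x.

Definition test_function phi : Prop :=
  smooth phi /\ compact (closure [set x : R | phi x != 0]).

Definition D_L1 phi : Prop :=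
  smooth phi /\ forall i, cintegrable (cderiven i phi).

Definition norm_L1 f : R := \int[mu]_x normc (f x).

Definition norm_m1 (m : nat) phi : R :=
  \sum_(0 <= i < m.+1) norm_L1 (cderiven i phi).

(* A functional is encoded as a total operator; only its values on [D_L1]
   matter.  As the norms [norm_m1 m] increase with [m], their balls form a
   neighbourhood basis of the Frechet topology, in which [bounded_distribution]
   expresses continuity at every point of [D_L1]. *)
Definition bounded_distribution T : Prop :=
  (forall (a : R[i]) phi psi, D_L1 phi -> D_L1 psi ->
     T (fun x => a * phi x + psi x) = a * T phi + T psi) /\
  (forall phi, D_L1 phi -> forall e : R, 0 < e ->
     exists m : nat, exists2 d : R, 0 < d &
       forall psi, D_L1 psi -> norm_m1 m (fun x => psi x - phi x) < d ->
         normc (T psi - T phi) < e).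

(* Equality in D', where distributions are only tested on [test_function]s. *)
Definition eq_distribution T S : Prop :=
  forall phi, test_function phi -> T phi = S phi.

Definition convolution T phi : R -> R[i] := fun x => T (fun y => phi (x - y)).

Definition regular_distribution f : (R -> R[i]) -> R[i] :=
  fun phi => cintegral (fun x => f x * phi x).

Definition distribution_derive T : (R -> R[i]) -> R[i] :=
  fun phi => - T (cderive phi).

Definition distribution_deriven (j : nat) T : (R -> R[i]) -> R[i] :=
  iter j distribution_derive T.

Definition almost_automorphic f : Prop :=
  continuous (f : R -> R[i]^o) /\
  forall s : nat -> R, exists2 k : nat -> nat,
    {homo k : m n / (m < n)%N} &
    exists g : R -> R[i],
      (forall x, (f (x + s (k n)) : R[i]^o) @[n --> \oo] --> (g x : R[i]^o)) /\
      (forall x, (g (x - s (k n)) : R[i]^o) @[n --> \oo] --> (f x : R[i]^o)).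

End Distributions.

(* Main.v *)
Require Import Defs.
From HB Require Import structures.
From mathcomp Require Import all_boot all_order all_algebra.
From mathcomp Require Import complex ring lra.
From mathcomp Require Import all_classical all_reals all_analysis.
From mathcomp Require Import measurable_realfun.

(** Everything reduces to real functionals [U] of finite order [m], that is,
    [|U p| <= C * rnorm m p].

    From convolutions to a representation: let [cutoff] be a truncated Heaviside
    function supported in [[-1, 0]], smooth except for its jump at [0].  Its
    derivative is a test function minus a Dirac mass at [0], so, up to signs,
    [U] is the derivative of [p |-> U (rconv cutoff p)] plus the distribution
    defined by [U * step'], which is almost automorphic by hypothesis.  The new
    functional has order [m - 1] and still satisfies the hypothesis, so one
    inducts on [m].  At order [0], [cutoff] is a limit in L^1 of test functions
    [cutoff_seq n], hence [p |-> U (rconv cutoff p)] is given by the uniform limit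
    of the almost automorphic functions [U * cutoff_seq n].

    Conversely, the convolution of an almost automorphic function with a test
    function is almost automorphic by dominated convergence. *)

Set Implicit Arguments.
Unset Strict Implicit.
Unset Printing Implicit Defensive.

Import Order.TTheory GRing.Theory Num.Theory.
Import numFieldNormedType.Exports.

Local Open Scope classical_set_scope.
Local Open Scope ring_scope.

(** * Smooth functions and a smooth step *)

(** Two obstacles shape the argument. The hypothesis speaks of [U * h] for test functions [h] only,
    whereas the exact primitive of a Dirac mass, a Heaviside function, is neither smooth nor
    compactly supported. Truncating it costs a remainder which is itself a test function and so
    falls under the hypothesis; smoothing its jump costs an error small in L^1, which a functional
    of order 0 tolerates. The order drops because one derivative of [rconv cutoff p] is absorbed by
    the kernel: the jump gives back [p], and the rest is a convolution of [p] with an integrable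
    function.

    The other obstacle is that writing [U (rconv h p)] as an integral of [U * h] against [p]
    exchanges an integral with a functional known only through linearity and a seminorm bound.
    Riemann sums settle this: they are finite combinations of translates, and they converge in
    [rnorm m] at rate [1 / n]. *)

Section SmoothFunctions.
Context {R : realType}.
Implicit Types (p q : R -> R) (x a b : R).

(* A record, so that unification does not unfold it. *)
Record rsmooth p : Prop :=
  RSmooth { derivable_derive1n : forall n x, derivable (derive1n n p) x 1 }.

Lemma rsmooth_coind (P : (R -> R) -> Prop) :
  (forall p, P p -> (forall x, derivable p x 1) /\ P (derive1 p)) ->
  forall p, P p -> rsmooth p.
Proof.
move=> HP p Pp; split=> n; suff /HP[] : P (derive1n n p) by [].
by elim: n => [//|n IH]; rewrite derive1nS; exact: (HP _ IH).2.
Qed.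

Lemma rsmooth_derive1n p n : rsmooth p -> rsmooth (derive1n n p).
Proof. by move=> [sp]; split=> m x; rewrite /derive1n -iterD; exact: sp. Qed.

Lemma rsmooth_derive1 p : rsmooth p -> rsmooth (derive1 p).
Proof. exact: (@rsmooth_derive1n _ 1). Qed.

Lemma rsmooth_derivable p x : rsmooth p -> derivable p x 1.
Proof. by move=> [/(_ 0%N x)]. Qed.

Lemma is_derive_derive1 p x : derivable p x 1 -> is_derive x 1 p (derive1 p x).
Proof. by move=> dp; rewrite derive1E; exact: DeriveDef. Qed.

Lemma rsmooth_is_derive p x : rsmooth p -> is_derive x 1 p (derive1 p x).
Proof. by move=> sp; exact/is_derive_derive1/rsmooth_derivable. Qed.

Lemma derive1_val p x d : is_derive x 1 p d -> derive1 p x = d.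
Proof. by move=> ?; rewrite derive1E derive_val. Qed.

Lemma rsmooth_continuous p : rsmooth p -> continuous p.
Proof.
by move=> sp x; apply/differentiable_continuous/derivable1_diffP/rsmooth_derivable.
Qed.

Lemma is_derive_mul p q x dp dq : is_derive x 1 p dp -> is_derive x 1 q dq ->
  is_derive x 1 (fun y => p y * q y) (p x * dq + q x * dp).
Proof. by move=> hp hq; exact: (@is_deriveM _ _ p q x 1 dp dq). Qed.

Lemma is_derive_lin a p q x dp dq : is_derive x 1 p dp -> is_derive x 1 q dq ->
  is_derive x 1 (fun y => a * p y + q y) (a * dp + dq).
Proof.
move=> hp hq.
exact: (@is_deriveD _ _ _ (a \*: p) q x 1 _ _ (is_deriveZ _ _)).
Qed.

(* The family [x^-k exp (- 1 / x)], whose span is stable under differentiation. *)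
Definition flat k x : R := if 0 < x then x^-1 ^+ k * expR (- x^-1) else 0.

Lemma is_derive_inv x : x != 0 -> is_derive x 1 (fun y => y^-1) (- x ^- 2).
Proof.
move=> x0; apply: is_derive_eq.
  exact: (@is_deriveV R id x 1 1 x0).
by rewrite scaler1.
Qed.

(** With [y = 1 / x], the single term [y^(k+2) / (k+2)!] of the exponential series dominates [y^k]
    and leaves a factor [x^2]. A quadratic bound is what makes [flat k] differentiable at 0, with
    derivative 0. *)
Lemma flat_le k x : `|flat k x| <= (k.+2)`!%:R * `|x| ^+ 2.
Proof.
rewrite /flat; case: ifPn => [x0|_]; last by rewrite normr0 mulr_ge0.
have y0 : 0 < x^-1 by rewrite invr_gt0.
rewrite ger0_norm; last by rewrite mulr_ge0 ?exprn_ge0 ?expR_ge0 ?ltW.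
rewrite expRN (gtr0_norm x0) ler_pdivrMr ?expR_gt0//.
have := @expR_ge1Dxn R x^-1 k.+1 (ltW y0) => /(le_trans _)-/(_ (x^-1 ^+ k.+2 / (k.+2)`!%:R)).
rewrite lerDr ler01 => /(_ isT).
have c0 : (0 : R) < (k.+2)`!%:R by rewrite ltr0n fact_gt0.
rewrite ler_pdivrMr// => H.
have -> : x^-1 ^+ k = x ^+ 2 * x^-1 ^+ k.+2.
  rewrite -[k.+2]addn2 exprD mulrCA -exprMn mulfV ?gt_eqF//.
  by rewrite expr1n mulr1.
rewrite [leRHS](_ : _ = x ^+ 2 * (expR x^-1 * (k.+2)`!%:R)); last by ring.
by rewrite ler_wpM2l// sqr_ge0.
Qed.

Lemma is_derive_flat k x :
  is_derive x 1 (flat k) (- k%:R * flat k.+1 x + flat k.+2 x).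
Proof.
have [x0|x0|x0] := ltgtP x 0.
- have E j : flat j x = 0 by rewrite /flat ltNge (ltW x0).
  rewrite !E mulr0 addr0.
  apply: (@near_eq_is_derive _ _ _ (cst 0)).
  near=> y; rewrite /flat ifF//; apply/negbTE; rewrite -leNgt ltW//.
  by near: y; exact: lt_nbhsl.
- have nx0 : x != 0 by rewrite gt_eqF.
  have HE : is_derive x 1 (fun y => y^-1 ^+ k * expR (- y^-1))
       (- k%:R * flat k.+1 x + flat k.+2 x).
    have H1 := is_derive_inv nx0.
    have H2 : is_derive x 1 (fun y => y^-1 ^+ k) (- k%:R * x^-1 ^+ k.+1).
      elim: (k) => [|j IH]; first by rewrite oppr0 mul0r; exact: is_derive_cst.
      have -> : (fun y : R => y^-1 ^+ j.+1) = (fun y => y^-1 * y^-1 ^+ j).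
        by apply/funext => y; rewrite exprS.
      have T := is_derive_mul H1 IH; apply: is_derive_eq.
      rewrite /GRing.scale/= -natr1 !exprS expr0; field; lra.
    have H3 : is_derive x 1 (fun y => expR (- y^-1)) (expR (- x^-1) * x ^- 2).
      apply: (@is_derive1_comp R expR (fun y => - y^-1)).
      by apply: is_derive_eq; rewrite opprK.
    have T := is_derive_mul H2 H3; apply: is_derive_eq.
    rewrite /flat x0 /GRing.scale/= !exprS; field; lra.
  apply: near_eq_is_derive HE.
  near=> y; rewrite /flat ifT//.
  by near: y; exact: lt_nbhsr.
- have E0 j : flat j 0 = 0 by rewrite /flat ltxx.
  rewrite x0 !E0 mulr0 addr0.
  (* By [flat_le] the difference quotient at 0 is at most [(k+2)! * |h|]. *)
  have D0 : (fun h : R => h^-1 *: ((flat k \o shift 0) (h *: (1:R)) - flat k 0)) @ 0^' --> (0 : R).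
    rewrite E0.
    apply/cvgr0Pnorm_le => e e0.
    near=> h.
    rewrite /= addr0 subr0 /GRing.scale/= mulr1 normrM normfV.
    have h0 : 0 < `|h| by rewrite normr_gt0; near: h; exact: nbhs_dnbhs_neq.
    rewrite mulrC ler_pdivrMr//.
    apply: (le_trans (flat_le k h)); rewrite expr2 mulrA ler_wpM2r//.
    have c0 : (0 : R) < (k.+2)`!%:R by rewrite ltr0n fact_gt0.
    rewrite mulrC -ler_pdivlMr//.
    near: h; apply: dnbhs0_le.
    exact: divr_gt0.
  split; first by apply/cvg_ex; exists 0; exact: D0.
  by apply: cvg_lim => //.
Unshelve. all: by end_near.
Qed.

(* This class is stable under differentiation, so [rsmooth_coind] applies to all
   its closure properties at once. *)
Inductive smooth_expr : (R -> R) -> Prop :=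
| SEbase p of rsmooth p : smooth_expr p
| SEcst a : smooth_expr (fun=> a)
| SEflat k : smooth_expr (flat k)
| SEadd p q of smooth_expr p & smooth_expr q : smooth_expr (fun x => p x + q x)
| SEmul p q of smooth_expr p & smooth_expr q : smooth_expr (fun x => p x * q x)
| SEinv p of smooth_expr p & (forall x, p x != 0) : smooth_expr (fun x => (p x)^-1)
| SEaff p a b of smooth_expr p : smooth_expr (fun x => p (a * x + b)).

Lemma is_derive_aff p a b x d : is_derive (a * x + b) 1 p d ->
  is_derive x 1 (fun x => p (a * x + b)) (a * d).
Proof.
move=> dp.
have -> : a * d = d * (a *: 1 + 0) by rewrite addr0 /GRing.scale/= mulr1 mulrC.
by apply: (@is_derive1_comp R p (fun x => a * x + b)).
Qed.

Lemma smooth_exprP p : smooth_expr p -> rsmooth p.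
Proof.
apply: rsmooth_coind => {}p sp.
suff [dp d sdp] : exists2 dp, (forall x, is_derive x 1 p (dp x)) & smooth_expr dp.
  split=> [x|]; first by case: (d x).
  suff -> : derive1 p = dp by [].
  by apply/funext => x; exact: derive1_val.
elim: sp => {p} [p sp|a|k|p q sp [dp dpE Hdp] sq [dq dqE Hdq]
  |p q sp [dp dpE Hdp] sq [dq dqE Hdq]|p sp [dp dpE Hdp] p0|p a b sp [dp dpE Hdp]].
- by exists (derive1 p) => [x|]; [exact: rsmooth_is_derive|exact/SEbase/rsmooth_derive1].
- by exists (fun=> 0) => [x|]; [exact: is_derive_cst|exact: SEcst].
- exists (fun x => - k%:R * flat k.+1 x + flat k.+2 x); first exact: is_derive_flat.
  by apply: SEadd (SEflat _); apply: SEmul (SEcst _) (SEflat _).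
- exists (fun x => dp x + dq x); last exact: SEadd.
  move=> x; have := is_derive_lin 1 (dpE x) (dqE x); rewrite mul1r.
  by under eq_fun do rewrite mul1r.
- exists (fun x => p x * dq x + q x * dp x); last by apply: SEadd; apply: SEmul.
  by move=> x; exact: is_derive_mul.
- exists (fun x => -1 * (((p x)^-1 * (p x)^-1) * dp x)).
    move=> x; have T := @is_deriveV R p x (dp x) 1 (p0 x) (dpE x).
    apply: is_derive_eq.
    by rewrite /GRing.scale/= expr2 invfM; ring.
  by apply: SEmul (SEcst _) _; apply: SEmul => //; apply: SEmul; apply: SEinv.
- exists (fun x => a * dp (a * x + b)).
    by move=> x; exact: is_derive_aff.
  by apply: SEmul (SEcst _) _; exact: SEaff.
Qed.

Lemma rsmooth_cst a : rsmooth (fun=> a).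
Proof. exact/smooth_exprP/SEcst. Qed.

Lemma rsmoothD p q : rsmooth p -> rsmooth q -> rsmooth (fun x => p x + q x).
Proof. by move=> ? ?; apply/smooth_exprP/SEadd; exact: SEbase. Qed.

Lemma rsmoothM p q : rsmooth p -> rsmooth q -> rsmooth (fun x => p x * q x).
Proof. by move=> ? ?; apply/smooth_exprP/SEmul; exact: SEbase. Qed.

Lemma rsmooth_aff p a b : rsmooth p -> rsmooth (fun x => p (a * x + b)).
Proof. by move=> ?; apply/smooth_exprP/SEaff; exact: SEbase. Qed.

Lemma derive1n_lin p q a n x : rsmooth p -> rsmooth q ->
  derive1n n (fun x => a * p x + q x) x = a * derive1n n p x + derive1n n q x.
Proof.
move=> sp sq; elim: n x => [//|n IH] x.
rewrite !derive1nS; have /funext -> := IH.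
apply: derive1_val.
by apply: is_derive_lin; exact/rsmooth_is_derive/rsmooth_derive1n.
Qed.

Lemma derive1n_aff p a b n x : rsmooth p ->
  derive1n n (fun x => p (a * x + b)) x = a ^+ n * derive1n n p (a * x + b).
Proof.
move=> sp; elim: n x => [|n IH] x; first by rewrite expr0 mul1r.
rewrite !derive1nS; have /funext -> := IH.
apply: derive1_val.
have dp := is_derive_aff (rsmooth_is_derive (a * x + b) (@rsmooth_derive1n p n sp)).
apply: is_derive_eq.
rewrite /GRing.scale/= exprS; ring.
Qed.

(** The usual smooth transition from 0 to 1 across [[0, 1]]; the denominator is positive because [x]
    or [1 - x] is. The form [-1 * x + 1] matches [SEaff]. *)
Definition step x : R := flat 0 x * (flat 0 x + flat 0 (-1 * x + 1))^-1.

Lemma flat0_gt0 x : 0 < x -> 0 < flat 0 x.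
Proof. by move=> x0; rewrite /flat x0 expr0 mul1r expR_gt0. Qed.

Lemma flat0_ge0 x : 0 <= flat 0 x.
Proof. by rewrite /flat; case: ifP => // _; rewrite expr0 mul1r expR_ge0. Qed.

Lemma step_den_gt0 x : 0 < flat 0 x + flat 0 (-1 * x + 1).
Proof.
have [x0|x0] := ltP 0 x; first by rewrite ltr_pwDl ?flat0_gt0 ?flat0_ge0.
by rewrite ltr_wpDl ?flat0_ge0 ?flat0_gt0//; lra.
Qed.

Lemma rsmooth_step : rsmooth step.
Proof.
apply: smooth_exprP; apply: SEmul; first exact: SEflat.
apply: SEinv => [|x]; last by rewrite gt_eqF ?step_den_gt0.
by apply: SEadd; [|apply: SEaff]; exact: SEflat.
Qed.

Lemma step_le0 x : x <= 0 -> step x = 0.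
Proof. by move=> x0; rewrite /step {1}/flat ltNge x0 mul0r. Qed.

Lemma step_ge1 x : 1 <= x -> step x = 1.
Proof.
move=> x1; rewrite /step {3}/flat ifF ?addr0 ?mulfV//; last by lra.
by rewrite gt_eqF// flat0_gt0//; lra.
Qed.

Lemma step_ge0 x : 0 <= step x.
Proof. by rewrite divr_ge0 ?flat0_ge0// ltW ?step_den_gt0. Qed.

Lemma step_le1 x : step x <= 1.
Proof. by rewrite ler_pdivrMr ?step_den_gt0// mul1r lerDl flat0_ge0. Qed.

End SmoothFunctions.

(** * Integrals and convolution *)

Section Convolution.
Context {R : realType}.
Implicit Types (p q h : R -> R) (x y u a b c : R).
Local Notation mu := (@lebesgue_measure R).
Local Notation integrable p := (mu.-integrable setT (EFin \o p)).

Definition csupp p := exists M : R, forall x, M < `|x| -> p x = 0.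

Definition test p := rsmooth p /\ csupp p.

(** The class of convolution kernels: wide enough for a kernel with a jump such as [cutoff], narrow
    enough for its convolution with any continuous function to converge. *)
Definition bcsupp h := [/\ measurable_fun setT h,
  exists C : R, forall x, `|h x| <= C & csupp h].

Lemma continuous_bounded p a b : continuous p ->
  exists2 C : R, 0 <= C & forall x, a <= x <= b -> `|p x| <= C.
Proof.
move=> cp; have [ab|ba] := leP a b; last first.
  by exists 0 => // x /andP[ax /(le_trans ax)]; rewrite leNgt ba.
have cn : continuous (fun x => `|p x|).
  by move=> x; apply: continuous_comp; [exact: cp|exact: norm_continuous].
have [c _ Hc] := EVT_max ab (continuous_subspaceT cn).
by exists `|p c| => // x xab; apply: Hc; rewrite in_itv.
Qed.

Lemma csupp_bounded p : continuous p -> csupp p ->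
  exists C : R, forall x, `|p x| <= C.
Proof.
move=> cp [M pM]; have [C C0 HC] := continuous_bounded (- M) M cp.
exists C => x; have [xM|/pM ->] := leP `|x| M; last by rewrite normr0.
by apply: HC; rewrite -ler_norml.
Qed.

Lemma continuous_bcsupp p : continuous p -> csupp p -> bcsupp p.
Proof.
move=> cp sp; split=> //; first exact: continuous_measurable_fun.
exact: csupp_bounded.
Qed.

Lemma mu_itvE a b : mu (`[a, b] : set R) = (Num.max 0 (b - a))%:E.
Proof.
rewrite lebesgue_measure_itv/= lte_fin -EFinB.
by have [ab|ba] := ltP a b; congr (_%:E); apply/esym; [apply: max_r|apply: max_l]; lra.
Qed.

Lemma mu_itv_lty a b : (mu (`[a, b] : set R) < +oo)%E.
Proof. by rewrite mu_itvE ltry. Qed.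

Lemma integrable_bcsupp h : bcsupp h -> integrable h.
Proof.
move=> [mh [C hC] [M hM]].
have : mu.-integrable `[- M, M] (EFin \o h).
  apply: measurable_bounded_integrable => //.
  - exact: (mu_itv_lty (- M) M).
  - exact: measurable_funS mh.
  - exists C; split; first exact: num_real.
    by move=> y Cy x _; exact: le_trans (hC x) (ltW Cy).
rewrite integrable_mkcond//; apply: eq_integrable => // x _.
rewrite patchE; case: ifPn => //; rewrite notin_setE/= in_itv/= => /negP.
by rewrite -ler_norml -ltNge => /hM ->.
Qed.

Lemma normr_integrable p : integrable p -> integrable (fun x => `|p x|).
Proof. by move=> /integrable_abse. Qed.

Lemma L1_bound h C M : 0 <= C -> 0 <= M -> (forall x, `|h x| <= C) ->
  (forall x, M < `|x| -> h x = 0) -> integrable h ->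
  \int[mu]_x `|h x| <= 2 * M * C.
Proof.
move=> C0 M0 hC hM ih.
rewrite (_ : (fun x => `|h x|) = (fun x => `|h x|) \_ `[- M, M]); last first.
  apply/funext => x; rewrite patchE; case: ifPn => //.
  rewrite notin_setE/= in_itv/= => /negP.
  by rewrite -ler_norml -ltNge => /hM ->; rewrite normr0.
rewrite -Rintegral_mkcond.
have iM f : continuous f -> mu.-integrable `[- M, M] (EFin \o f).
  move=> cf; apply: continuous_compact_integrable; first exact: segment_compact.
  exact: continuous_subspaceT.
apply: (@le_trans _ _ (\int[mu]_(x in `[- M, M]) C)).
  apply: le_Rintegral => //.
  - by apply: integrableS (normr_integrable ih).
  - by apply: iM => x; exact: cst_continuous.
rewrite Rintegral_cst// [X in fine X](mu_itvE (- M) M)/= max_r; last by lra.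
lra.
Qed.

Lemma measurable_reflect c : measurable_fun setT (fun x : R => c - x).
Proof.
apply: continuous_measurable_fun => x.
by apply: cvgB; [exact: cvg_cst|exact: cvg_id].
Qed.

(** By uniqueness of Lebesgue measure, half-open intervals suffice; reflection moves the closed end
    to the other side and keeps the length. *)
Lemma lebesgue_measure_reflect c (A : set R) : measurable A ->
  pushforward mu ((fun x => c - x) : R -> measurableTypeR R) A = mu A.
Proof.
move=> mA; apply/esym/lebesgue_measure_unique => //=.
  exact: measurable_reflect.
move=> _ _ [[a b]] _ <-.
rewrite /pushforward/=.
rewrite (_ : _ @^-1` _ = `[c - b, c - a[%classic); last first.
  by apply/seteqP; split=> x /=; rewrite !in_itv/=; lra.
rewrite !lebesgue_measure_itv/= !lte_fin ltrD2l ltrN2.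
by case: ifP => // _; congr (_%:E); ring.
Qed.

Local Open Scope ereal_scope.

Lemma ge0_integral_reflect c (f : R -> \bar R) : measurable_fun setT f ->
  (forall x, 0 <= f x) -> \int[mu]_x f (c - x)%R = \int[mu]_x f x.
Proof.
move=> mf f0.
rewrite -[LHS](@ge0_integral_pushforward _ _ (measurableTypeR R) (measurableTypeR R) _
  (fun x => c - x)%R (measurable_reflect c) mu setT f)//.
apply: eq_measure_integral => //=; first exact: measurable_reflect.
by move=> _ A mA _; exact: lebesgue_measure_reflect.
Qed.

(** A translation is the composite of the reflections about [0] and about [c / 2]. *)
Lemma ge0_integral_shift c (f : R -> \bar R) : measurable_fun setT f ->
  (forall x, 0 <= f x) -> \int[mu]_x f (x - c)%R = \int[mu]_x f x.
Proof.
move=> mf f0; rewrite -[RHS](ge0_integral_reflect 0)//.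
rewrite -[RHS](ge0_integral_reflect c)//.
  by apply: eq_integral => x _; rewrite sub0r opprB.
by apply: measurableT_comp => //; exact: measurable_reflect.
Qed.

Local Close Scope ereal_scope.

Lemma measurable_comp_reflect p c : measurable_fun setT p ->
  measurable_fun setT (fun x => p (c - x)).
Proof. by move=> mp; apply: measurableT_comp => //; exact: measurable_reflect. Qed.

Lemma Rintegral_reflect p c : integrable p ->
  \int[mu]_x p (c - x) = \int[mu]_x p x.
Proof.
move=> ip; have /integrableP[mp _] := ip.
rewrite /Rintegral integralE [in RHS]integralE; congr fine.
congr (_ - _)%E.
- rewrite -[RHS](ge0_integral_reflect c)//; last exact: measurable_funepos mp.
  by apply: eq_integral => x _; rewrite !funeposE.
- rewrite -[RHS](ge0_integral_reflect c)//; last exact: measurable_funeneg mp.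
  by apply: eq_integral => x _; rewrite !funenegE.
Qed.

(** The roles are asymmetric: [h] is a rough kernel in [bcsupp], [p] is continuous or smooth with no
    growth condition, and all derivatives fall on [p]. *)
Definition rconv h p y := \int[mu]_u (h u * p (y - u)).

Lemma integrable_rconv h p y : bcsupp h -> continuous p ->
  integrable (fun u => h u * p (y - u)).
Proof.
move=> [mh [C hC] [M hM]] cp; apply: integrable_bcsupp; split.
- apply: measurable_funM => //; apply: measurable_comp_reflect.
  exact: continuous_measurable_fun.
- have [D D0 HD] := continuous_bounded (y - M) (y + M) cp.
  exists (C * D) => x; have [xM|/hM ->] := leP `|x| M; last first.
    by rewrite mul0r normr0 mulr_ge0 ?(le_trans _ (hC 0)).
  rewrite normrM ler_pM//; apply: HD.
  by move: xM; rewrite ler_norml; lra.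
- by exists M => x /hM ->; rewrite mul0r.
Qed.

Lemma is_derive_rconv h p y : bcsupp h -> rsmooth p ->
  is_derive y 1 (rconv h p) (rconv h (derive1 p) y).
Proof.
move=> bh sp.
have [mh [C hC] [M hM]] := bh.
have sp' := rsmooth_derive1 sp.
(* For [z] within 1 of [y] and [u] in the support of [h], the point [z - u] stays in this segment,
   so [|h u| * D] dominates the derivative in [z] of the integrand. *)
have [D D0 HD] := continuous_bounded (y - 1 - M) (y + 1 + M) (rsmooth_continuous sp').
have dE x u : is_derive x 1 (fun z => h u * p (z - u)) (h u * derive1 p (x - u)).
  have H : is_derive x 1 (fun z => p (1 * z + - u)) (1 * derive1 p (1 * x + - u)).
    exact/is_derive_aff/rsmooth_is_derive.
  have := is_derive_lin (h u) H (is_derive_cst (0 : R) x 1).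
  rewrite !mul1r addr0 => H'.
  apply: near_eq_is_derive H'; near=> z.
  by rewrite /= mul1r addr0.
have yI : `]y - 1, y + 1[%classic y by rewrite /= in_itv/=; lra.
pose f x u := h u * p (x - u).
have intf x : `]y - 1, y + 1[%classic x -> mu.-integrable setT (EFin \o f x).
  by move=> _; apply: integrable_rconv => //; exact: rsmooth_continuous.
have df (x u : R) : `]y - 1, y + 1[%classic x -> setT u -> derivable (f ^~ u) x 1.
  by move=> _ _; case: (dE x u).
have iG : integrable (fun u => `|h u| * D).
  apply: integrable_bcsupp; split.
  - by apply: measurable_funM => //; apply: measurableT_comp.
  - by exists (C * D) => u; rewrite normrM normr_id ler_pM// ger0_norm.
  - by exists M => u /hM ->; rewrite normr0 mul0r.
have dG (x u : R) : `]y - 1, y + 1[%classic x -> setT u ->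
    `|partial1of2 f x u| <= `|h u| * D.
  rewrite /= in_itv/= => xy _; rewrite /partial1of2.
  rewrite (derive1_val (dE x u)) normrM.
  have [xM|/hM ->] := leP `|u| M; last by rewrite normr0 !mul0r.
  rewrite ler_wpM2l//; apply: HD.
  by move: xM; rewrite ler_norml; lra.
have G0 u : 0 <= `|h u| * D by rewrite mulr_ge0.
rewrite (_ : rconv h (derive1 p) y = derive1 (rconv h p) y).
  apply: is_derive_derive1.
  exact: (derivable_under_integral _ yI intf df G0 iG dG).
rewrite (differentiation_under_integral _ yI intf df G0 iG dG)//.
apply: eq_Rintegral => u _; rewrite /partial1of2.
by rewrite (derive1_val (dE y u)).
Unshelve. all: by end_near.
Qed.

Lemma derive1_rconv h p : bcsupp h -> rsmooth p ->
  derive1 (rconv h p) = rconv h (derive1 p).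
Proof. by move=> bh sp; apply/funext => y; exact/derive1_val/is_derive_rconv. Qed.

Lemma rsmooth_rconv h p : bcsupp h -> rsmooth p -> rsmooth (rconv h p).
Proof.
move=> bh sp; apply: (@rsmooth_coind _ (fun q => exists2 p, rsmooth p & q = rconv h p)).
  move=> _ [q sq ->]; split=> [x|]; first by case: (is_derive_rconv x bh sq).
  by exists (derive1 q); [exact: rsmooth_derive1|exact: derive1_rconv].
by exists p.
Qed.

Lemma derive1n_rconv h p n : bcsupp h -> rsmooth p ->
  derive1n n (rconv h p) = rconv h (derive1n n p).
Proof.
move=> bh sp; elim: n => [//|n IH].
by rewrite !derive1nS IH derive1_rconv//; exact: rsmooth_derive1n.
Qed.

(** Young's inequality for L^1, from Tonelli and translation invariance. It is proved in the
    extended reals, so that the same bound gives integrability. *)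
Lemma rconv_L1 h p : bcsupp h -> rsmooth p -> integrable p ->
  integrable (rconv h p) /\
  \int[mu]_y `|rconv h p y| <= (\int[mu]_u `|h u|) * \int[mu]_u `|p u|.
Proof.
move=> bh sp ip.
have ih := integrable_bcsupp bh.
have [mh [C hC] [M hM]] := bh.
have cp := rsmooth_continuous sp.
have mp := continuous_measurable_fun cp.
have mc := continuous_measurable_fun (rsmooth_continuous (rsmooth_rconv bh sp)).
have le y : (`|rconv h p y|%:E <= \int[mu]_u (`|h u| * `|p (y - u)|)%:E)%E.
  have ihp := integrable_rconv y bh cp.
  rewrite /rconv EFin_normr_Rintegral//.
  apply: le_trans (le_abse_integral _ _ _) _ => //.
    by case/integrableP : ihp.
  rewrite le_eqVlt; apply/orP; left; apply/eqP.
  by apply: eq_integral => u _ /=; rewrite normrM.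
have mK : measurable_fun setT (fun z : measurableTypeR R * measurableTypeR R =>
    (`|h z.2| * `|p (z.1 - z.2)|)%:E).
  apply/measurable_EFinP; apply: measurable_funM.
    by apply: measurableT_comp => //; apply: measurableT_comp.
  apply: measurableT_comp => //; apply: measurableT_comp => //.
  by apply: measurable_funB.
have H : (\int[mu]_y `|rconv h p y|%:E <=
    (\int[mu]_u `|h u|%:E) * (\int[mu]_u `|p u|%:E))%E.
  apply: (@le_trans _ _ (\int[mu]_y \int[mu]_u (`|h u| * `|p (y - u)|)%:E)%E).
    apply: ge0_le_integral => //.
    - by apply/measurable_EFinP; apply: measurableT_comp.
    - exact: (@measurable_fun_fubini_tonelli_F _ _ _ _ _ mu _ mK).
  rewrite (@fubini_tonelli _ _ _ _ _ mu mu _ mK)/=; last first.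
    by move=> z; rewrite lee_fin mulr_ge0.
  under eq_integral => u _.
    under eq_integral do rewrite EFinM.
    rewrite ge0_integralZl_EFin//; last first.
      apply/measurable_EFinP; apply: measurableT_comp => //.
      by apply: measurableT_comp => //; exact: measurable_funB.
    rewrite (ge0_integral_shift u (f := fun x => `|p x|%:E))//; last first.
      by apply/measurable_EFinP; apply: measurableT_comp.
    over.
  rewrite ge0_integralZr//; first by apply/measurable_EFinP; apply: measurableT_comp.
  by apply: integral_ge0.
have fin f : integrable f -> (\int[mu]_x `|f x|%:E)%E = (\int[mu]_x `|f x|)%:E.
  move=> /normr_integrable jf; rewrite /Rintegral fineK//.
  exact: integrable_fin_num.
rewrite (fin h)// (fin p)// -EFinM in H.
have ic : integrable (rconv h p).
  apply/integrableP; split; first exact/measurable_EFinP.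
  by apply: le_lt_trans H _; rewrite ltry.
by split=> //; rewrite fin// lee_fin in H.
Qed.

End Convolution.

(** * Test functions and the seminorms of D_L1 *)

Section Seminorms.
Context {R : realType}.
Implicit Types (p q h : R -> R) (x y u a b c : R).
Local Notation mu := (@lebesgue_measure R).
Local Notation integrable p := (mu.-integrable setT (EFin \o p)).

Lemma rsmooth_lin a p q : rsmooth p -> rsmooth q -> rsmooth (fun x => a * p x + q x).
Proof. by move=> sp sq; apply: rsmoothD => //; apply: rsmoothM => //; exact: rsmooth_cst. Qed.

Lemma csupp_lin a p q : csupp p -> csupp q -> csupp (fun x => a * p x + q x).
Proof.
move=> [M hM] [N hN]; exists (Num.max M N) => x; rewrite gt_max => /andP[xM xN].
by rewrite hM// hN// mulr0 addr0.
Qed.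

(** The set [M < |x|] is open, so [p] vanishes near each of its points. A negative [M] is allowed:
    with [M = -1] the set is the whole line, and the derivatives of the zero function are seen to
    vanish. *)
Lemma derive1n_outside p M n : (forall x, M < `|x| -> p x = 0) ->
  forall x, M < `|x| -> derive1n n p x = 0.
Proof.
move=> hM; elim: n => [//|n IH] x xM; rewrite derive1nS; apply: derive1_val.
apply: (@near_eq_is_derive _ _ _ (cst 0)).
have e0 : 0 < `|x| - M by rewrite subr_gt0.
near=> y; rewrite IH//.
have : `|x - y| < `|x| - M.
  by near: y; apply: (@cvgr_dist_lt _ _ _ (nbhs x) _ id x) => //; exact: cvg_id.
have := lerB_dist x y; lra.
Unshelve. all: by end_near.
Qed.

Lemma csupp_derive1n p n : csupp p -> csupp (derive1n n p).
Proof. by move=> [M hM]; exists M; exact: derive1n_outside. Qed.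

Lemma csupp_reflect p c : csupp p -> csupp (fun x => p (c - x)).
Proof.
move=> [M hM]; exists (M + `|c|) => x xM; apply: hM.
have := lerB_dist x c; rewrite distrC; lra.
Qed.

Lemma csupp_shift p c : csupp p -> csupp (fun x => p (x - c)).
Proof.
move=> [M hM]; exists (M + `|c|) => x xM; apply: hM.
have := lerB_dist x c; lra.
Qed.

Lemma rsmooth_reflect p c : rsmooth p -> rsmooth (fun x => p (c - x)).
Proof.
move=> /(@rsmooth_aff _ _ (-1) c).
by under eq_fun do rewrite mulN1r addrC.
Qed.

Lemma derive1n_reflect p c n x : rsmooth p ->
  derive1n n (fun x => p (c - x)) x = (-1) ^+ n * derive1n n p (c - x).
Proof.
move=> /(@derive1n_aff _ _ (-1) c n x) H; rewrite mulN1r addrC in H.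
by rewrite -H; congr (derive1n n _ x); apply/funext => y; rewrite mulN1r addrC.
Qed.

Lemma rsmooth_shift p c : rsmooth p -> rsmooth (fun x => p (x - c)).
Proof.
by move=> /(@rsmooth_aff _ _ 1 (- c)); under eq_fun do rewrite mul1r.
Qed.

Lemma derive1n_shift p c n : rsmooth p ->
  derive1n n (fun x => p (x - c)) = fun x => derive1n n p (x - c).
Proof.
move=> sp; apply/funext => x.
have := @derive1n_aff _ p 1 (- c) n x sp; rewrite expr1n !mul1r => <-.
by congr (derive1n n _ x); apply/funext => y; rewrite mul1r.
Qed.

Lemma csupp_rconv h p : bcsupp h -> csupp p -> csupp (rconv h p).
Proof.
move=> [_ _ [M hM]] [N hN]; exists (M + N) => x xMN.
rewrite /rconv (@eq_Rintegral _ _ _ _ _ (cst 0)) ?Rintegral_cst ?mul0r// => u _ /=.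
have [uM|/hM ->] := leP `|u| M; last by rewrite mul0r.
rewrite hN ?mulr0//; have := lerB_dist x u; lra.
Qed.

Lemma test_derive1n p n : test p -> test (derive1n n p).
Proof. by move=> [sp cp]; split; [exact: rsmooth_derive1n|exact: csupp_derive1n]. Qed.

Lemma test_reflect p c : test p -> test (fun x => p (c - x)).
Proof. by move=> [sp cp]; split; [exact: rsmooth_reflect|exact: csupp_reflect]. Qed.

Lemma test_shift p c : test p -> test (fun x => p (x - c)).
Proof. by move=> [sp cp]; split; [exact: rsmooth_shift|exact: csupp_shift]. Qed.

Lemma test_rconv h p : bcsupp h -> test p -> test (rconv h p).
Proof. by move=> bh [sp cp]; split; [exact: rsmooth_rconv|exact: csupp_rconv]. Qed.

Lemma test_bcsupp p : test p -> bcsupp p.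
Proof. by move=> [sp cp]; apply: continuous_bcsupp => //; exact: rsmooth_continuous. Qed.

Lemma bcsupp_lin a p q : bcsupp p -> bcsupp q -> bcsupp (fun x => a * p x + q x).
Proof.
move=> [mp [C hC] cp] [mq [D hD] cq]; split; last exact: csupp_lin.
  by apply: measurable_funD => //; exact: measurable_funM.
exists (`|a| * C + D) => x; apply: le_trans (ler_normD _ _) _.
by rewrite lerD// normrM ler_wpM2l.
Qed.

Lemma integrable_lin a p q : integrable p -> integrable q ->
  integrable (fun x => a * p x + q x).
Proof.
move=> ip iq.
have -> : EFin \o (fun x => a * p x + q x) =
  ((fun x => a%:E * (EFin \o p) x) \+ (EFin \o q))%E by [].
by apply: integrableD => //; apply: integrableZl.
Qed.

Lemma Rintegral_lin a p q : integrable p -> integrable q ->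
  \int[mu]_x (a * p x + q x) = a * (\int[mu]_x p x) + \int[mu]_x q x.
Proof.
move=> ip iq; rewrite RintegralD// ?RintegralZl//.
have -> : EFin \o (fun x => a * p x) = (fun x => a%:E * (EFin \o p) x)%E by [].
exact: integrableZl.
Qed.

Lemma rconvC h p : bcsupp h -> continuous p -> rconv h p = rconv p h.
Proof.
move=> bh cp; apply/funext => y.
rewrite /rconv -[LHS](@Rintegral_reflect _ _ y); last exact: integrable_rconv.
by apply: eq_Rintegral => u _; rewrite subKr mulrC.
Qed.

Lemma rconv_linr a h p q : bcsupp h -> continuous p -> continuous q ->
  rconv h (fun x => a * p x + q x) = fun x => a * rconv h p x + rconv h q x.
Proof.
move=> bh cp cq; apply/funext => y; rewrite /rconv -Rintegral_lin; last 2 first.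
- exact: integrable_rconv.
- exact: integrable_rconv.
by apply: eq_Rintegral => u _; rewrite mulrDr mulrCA.
Qed.

Lemma rconv_linl a h1 h2 p : bcsupp h1 -> bcsupp h2 -> continuous p ->
  rconv (fun x => a * h1 x + h2 x) p = fun x => a * rconv h1 p x + rconv h2 p x.
Proof.
move=> bh1 bh2 cp; apply/funext => y; rewrite /rconv -Rintegral_lin; last 2 first.
- exact: integrable_rconv.
- exact: integrable_rconv.
by apply: eq_Rintegral => u _; rewrite mulrDl mulrA.
Qed.

Definition L1 p := \int[mu]_x `|p x|.

Lemma L1_ge0 p : 0 <= L1 p.
Proof. exact: Rintegral_ge0. Qed.

Lemma L1_lin a p q : integrable p -> integrable q ->
  L1 (fun x => a * p x + q x) <= `|a| * L1 p + L1 q.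
Proof.
move=> ip iq; rewrite /L1 -Rintegral_lin; [|exact: normr_integrable..].
apply: le_Rintegral => //.
- exact/normr_integrable/integrable_lin.
- by apply: integrable_lin; exact: normr_integrable.
- by move=> x _; rewrite -normrM ler_normD.
Qed.

Definition rD_L1 p := rsmooth p /\ forall n, integrable (derive1n n p).

Definition rnorm m p := \sum_(i < m.+1) L1 (derive1n i p).

Lemma rnorm_ge0 m p : 0 <= rnorm m p.
Proof. by apply: sumr_ge0 => i _; exact: L1_ge0. Qed.

Lemma test_rD p : test p -> rD_L1 p.
Proof.
move=> tp; split; first by case: tp.
by move=> n; apply/integrable_bcsupp/test_bcsupp/test_derive1n.
Qed.

Lemma rD_lin a p q : rD_L1 p -> rD_L1 q -> rD_L1 (fun x => a * p x + q x).
Proof.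
move=> [sp ip] [sq iq]; split=> [|n].
  exact: rsmooth_lin.
rewrite (_ : derive1n n _ = fun x => a * derive1n n p x + derive1n n q x).
  exact: integrable_lin.
by apply/funext => x; exact: derive1n_lin.
Qed.

Lemma rnorm_lin m a p q : rD_L1 p -> rD_L1 q ->
  rnorm m (fun x => a * p x + q x) <= `|a| * rnorm m p + rnorm m q.
Proof.
move=> [sp ip] [sq iq]; rewrite /rnorm mulr_sumr -big_split/=.
apply: ler_sum => i _.
rewrite (_ : derive1n i _ = fun x => a * derive1n i p x + derive1n i q x).
  exact: L1_lin.
by apply/funext => x; exact: derive1n_lin.
Qed.

Lemma rD_rconv h p : bcsupp h -> rD_L1 p -> rD_L1 (rconv h p).
Proof.
move=> bh [sp ip]; split=> [|n]; first exact: rsmooth_rconv.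
rewrite (derive1n_rconv _ bh sp).
exact: (rconv_L1 bh (rsmooth_derive1n n sp) (ip n)).1.
Qed.

Lemma L1_rconv h p n : bcsupp h -> rD_L1 p ->
  L1 (derive1n n (rconv h p)) <= L1 h * L1 (derive1n n p).
Proof.
move=> bh [sp ip]; rewrite (derive1n_rconv _ bh sp).
exact: (rconv_L1 bh (rsmooth_derive1n n sp) (ip n)).2.
Qed.

End Seminorms.

(** * Almost automorphic functions *)

Lemma homo_ltn_ge (k : nat -> nat) n : {homo k : m n / (m < n)%N} -> (n <= k n)%N.
Proof.
by move=> hk; elim: n => [//|n IH]; apply: leq_ltn_trans IH _; exact: hk.
Qed.

Section AlmostAutomorphic.
Context {R : realType}.
Implicit Types (f g p : R -> R) (s : nat -> R) (x : R).
Local Notation mu := (@lebesgue_measure R).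
Local Notation integrable p := (mu.-integrable setT (EFin \o p)).

Definition aa_along f g s :=
  (forall x, f (x + s n) @[n --> \oo] --> g x) /\
  (forall x, g (x - s n) @[n --> \oo] --> f x).

Definition raa f := continuous f /\
  forall s, exists2 k : nat -> nat, {homo k : m n / (m < n)%N} &
    exists g, aa_along f g (s \o k).

Lemma cvg_extract (T : topologicalType) (u : nat -> T) (l : T) (k : nat -> nat) N :
  (forall j, (N <= j)%N -> (j <= k j)%N) ->
  u n @[n --> \oo] --> l -> u (k n) @[n --> \oo] --> l.
Proof.
move=> hk ul; apply: (cvg_comp k u _ ul) => A [M _ MA].
exists (maxn N M) => // j /=; rewrite geq_max => /andP[Nj Mj].
by apply: MA => /=; apply: leq_trans (hk _ Nj).
Qed.

(** It is enough that [s'] be drawn from [s] from rank [N] on, at indices [l >= j]: this is how a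
    diagonal sequence sits inside the [N]-th extraction. *)
Lemma aa_along_extract f g s s' N :
  (forall j, (N <= j)%N -> exists2 l, (j <= l)%N & s' j = s l) ->
  aa_along f g s -> aa_along f g s'.
Proof.
move=> hs [fg gf].
have /choice[k hk] : forall j, exists l, (N <= j)%N -> (j <= l)%N /\ s' j = s l.
  move=> j; have [/hs[l jl sl]|_] := leqP N j; last by exists 0%N.
  by exists l.
have near_s' : \forall j \near \oo, s' j = s (k j).
  by exists N => // j /= /hk[].
have kj j : (N <= j)%N -> (j <= k j)%N by move/hk => [].
split=> x.
  apply: cvg_trans (cvg_extract kj (fg x)).
  apply: near_eq_cvg; near=> j; congr (f (x + _)).
  by apply/esym; near: j.
apply: cvg_trans (cvg_extract kj (gf x)).
apply: near_eq_cvg; near=> j; congr (g (x - _)).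
by apply/esym; near: j.
Unshelve. all: by end_near.
Qed.

(* Cantor's diagonal over the nested subsequences [K n]. *)
Lemma raa_common (F : nat -> R -> R) s : (forall n, raa (F n)) ->
  exists2 k : nat -> nat, {homo k : m n / (m < n)%N} &
    exists G : nat -> R -> R, forall n, aa_along (F n) (G n) (s \o k).
Proof.
move=> hF.
have /choice[kk hkk] : forall ns : nat * (nat -> R), exists k : nat -> nat,
    {homo k : m n / (m < n)%N} /\ exists g, aa_along (F ns.1) g (ns.2 \o k).
  by move=> [n t]; have [k hk gk] := (hF n).2 t; exists k.
pose fix K n : nat -> nat :=
  if n is m.+1 then K m \o kk (n, s \o K m) else kk (0%N, s).
have K_homo n : {homo K n : i j / (i < j)%N}.
  elim: n => [|n IH] i j ij /=; first exact: (hkk (0%N, s)).1.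
  by apply: IH; exact: (hkk (n.+1, s \o K n)).1.
have K_good n : exists g, aa_along (F n) g (s \o K n).
  by case: n => [|n]; [exact: (hkk (0%N, s)).2|exact: (hkk (n.+1, s \o K n)).2].
have K_sub n i : exists2 psi : nat -> nat, {homo psi : m n / (m < n)%N} &
    K (i + n)%N =1 K n \o psi.
  elim: i => [|i [psi hpsi E]]; first by exists id.
  exists (psi \o kk ((i + n).+1, s \o K (i + n)%N)) => [m m' mm'|m /=].
    by apply: hpsi; exact: (hkk (_, _)).1.
  by rewrite E.
exists (fun j => K j j).
  apply: homo_ltn => [y x z|j] /=; first exact: ltn_trans.
  apply: K_homo; apply: leq_ltn_trans (homo_ltn_ge j (hkk (j.+1, s \o K j)).1) _.
  by apply: (hkk (j.+1, s \o K j)).1.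
have /choice[G hG] := K_good.
exists G => n; apply: (@aa_along_extract _ _ (s \o K n) _ n) (hG n) => j nj.
have [psi hpsi E] := K_sub n (j - n)%N; rewrite subnK// in E.
by exists (psi j); [exact: homo_ltn_ge|rewrite /= E].
Qed.

Lemma raa_common2 f1 f2 s : raa f1 -> raa f2 ->
  exists2 k : nat -> nat, {homo k : m n / (m < n)%N} &
    exists g1 g2 , aa_along f1 g1 (s \o k) /\ aa_along f2 g2 (s \o k).
Proof.
move=> h1 h2.
have [|k hk [G hG]] := @raa_common (fun n => if n is 0 then f1 else f2) s.
  by case.
by exists k => //; exists (G 0%N), (G 1%N); split; [exact: (hG 0%N)|exact: (hG 1%N)].
Qed.

Lemma raa_lin a f1 f2 : raa f1 -> raa f2 -> raa (fun x => a * f1 x + f2 x).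
Proof.
move=> h1 h2; split=> [x|s].
  by apply: cvgD; [apply: cvgMr; exact: h1.1|exact: h2.1].
have [k hk [g1 [g2 [[a1 b1] [a2 b2]]]]] := raa_common2 s h1 h2.
exists k => //; exists (fun x => a * g1 x + g2 x).
by split=> x; apply: cvgD => //; apply: cvgMr.
Qed.

Lemma raa0 : raa (fun=> 0).
Proof.
split=> [x|s]; first exact: cvg_cst.
by exists id => //; exists (fun=> 0); split=> x; exact: cvg_cst.
Qed.

(** If [|f (s n)| > n] for all [n], then [f (0 + s (k n))] cannot converge along any extraction [k],
    since [k n >= n]. *)
Lemma raa_bounded f : raa f -> exists C, forall x, `|f x| <= C.
Proof.
move=> [_ hf]; apply: contrapT => nf.
have /choice[s hs] : forall n : nat, exists x, n%:R < `|f x|.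
  move=> n; apply: contrapT => hn; apply: nf; exists n%:R => x.
  by rewrite leNgt; apply/negP => xn; apply: hn; exists x.
have [k hk [g [fg _]]] := hf s.
have /cvgrPdist_lt/(_ 1 ltr01)[N _ HN] := fg 0.
have [M HM] : exists M : nat, `|g 0| + 1 <= M%:R.
  by exists (Num.bound (`|g 0| + 1)); rewrite ltW// archi_boundP.
pose n := maxn N M.
have := HN n (leq_maxl _ _); rewrite /= add0r => H1.
have H2 := hs (k n).
have H3 : (M%:R : R) <= (k n)%:R.
  rewrite ler_nat (leq_trans _ (homo_ltn_ge n hk))//; exact: leq_maxr.
have := lerB_dist (f (s (k n))) (g 0); rewrite distrC; lra.
Qed.

(** A three-epsilon argument along one subsequence that serves all the [F n] at once. The translates
    of [f] converge along it because they are Cauchy, and their limit [g] is the uniform limit of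
    the limits [G n]. *)
Lemma raa_uniform_lim (F : nat -> R -> R) f (e : nat -> R) :
  (forall n, raa (F n)) -> e n @[n --> \oo] --> 0 ->
  (forall n x, `|F n x - f x| <= e n) -> raa f.
Proof.
move=> hF e0 Ff.
have small d : 0 < d -> exists n, e n < d.
  move=> d0; move/cvgrPdist_lt : e0 => /(_ d d0)[N _ /(_ N (leqnn N))].
  by rewrite sub0r normrN => /(le_lt_trans (ler_norm _)); exists N.
split=> [x|s].
  apply/cvgrPdist_lt => d d0.
  have [|n en] := small (d / 3); first lra.
  near=> y.
  have H : `|F n x - F n y| < d / 3.
    by near: y; apply: (cvgr_dist_lt _ _ ((hF n).1 x)); lra.
  have := Ff n x; have := Ff n y.
  move: H; rewrite !ltr_norml !ler_norml; lra.
have [k hk [G hG]] := raa_common s hF.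
exists k => //.
pose t := s \o k.
have fc x : cvgn (fun n => f (x + t n)).
  apply/cauchy_cvgP/cauchy_exP => d d0.
  have [|n en] := small (d / 3); first lra.
  exists (G n x).
  suff : \forall j \near \oo, ball (G n x) d (f (x + t j)) by [].
  near=> j.
  have H : `|G n x - F n (x + t j)| < d / 3.
    by near: j; apply: (cvgr_dist_lt _ _ ((hG n).1 x)); lra.
  have := Ff n (x + t j); rewrite -ball_normE/=.
  move: H; rewrite !ltr_norml !ler_norml; lra.
pose g x := lim (f (x + t n) @[n --> \oo]).
have fg x : f (x + t n) @[n --> \oo] --> g x by exact: fc.
(* Uniformity in [x] matters here: the return limit evaluates [g] at the moving point [x - t j]. *)
have Gg n x : `|G n x - g x| <= e n.
  have H : `|F n (x + t j) - f (x + t j)| @[j --> \oo] --> `|G n x - g x|.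
    by apply: cvg_norm; apply: cvgB; [exact: (hG n).1|exact: fg].
  apply: (ler_cvg_to H (cvg_cst (e n))).
  by near=> j; exact: Ff.
exists g; split=> // x.
apply/cvgrPdist_lt => d d0.
have [|n en] := small (d / 3); first lra.
near=> j.
have H : `|F n x - G n (x - t j)| < d / 3.
  by near: j; apply: (cvgr_dist_lt _ _ ((hG n).2 x)); lra.
have := Ff n x; have := Gg n (x - t j); rewrite /t/=.
move: H; rewrite !ltr_norml !ler_norml /t /=; lra.
Unshelve. all: by end_near.
Qed.

Lemma Rdominated_cvg (F : nat -> R -> R) f g :
  (forall n, measurable_fun setT (F n)) -> measurable_fun setT f ->
  integrable g -> (forall n x, `|F n x| <= g x) ->
  (forall x, F n x @[n --> \oo] --> f x) ->
  (\int[mu]_x F n x) @[n --> \oo] --> \int[mu]_x f x.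
Proof.
move=> mF mf ig Fg Ff.
have [||||? _ H] := @dominated_convergence _ _ _ mu setT measurableT
  (fun n => EFin \o F n) (EFin \o f) (EFin \o g) _ _ _ ig _.
- by move=> n; apply/measurable_EFinP; exact: mF.
- exact/measurable_EFinP.
- apply: aeW => x _; apply: cvg_EFin; last exact: Ff.
  by near=> n.
- by apply: aeW => x n _; rewrite /= lee_fin Fg.
apply: fine_cvg; rewrite /Rintegral fineK; first exact: H.
exact: integrable_fin_num.
Unshelve. all: by end_near.
Qed.

Lemma raa_measurable f : raa f -> measurable_fun setT f.
Proof. by move=> [cf _]; exact: continuous_measurable_fun. Qed.

Lemma raa_rconv p f : test p -> raa f -> raa (rconv p f).
Proof.
move=> tp hf.
have [C hC] := raa_bounded hf.
have bp := test_bcsupp tp.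
have mp : measurable_fun setT p by case: bp.
have ig : integrable (fun u => `|p u| * C).
  apply: integrable_bcsupp; case: bp => _ [D hD] [M hM]; split.
  - by apply: measurable_funM => //; exact: measurableT_comp.
  - exists (D * `|C|) => x; rewrite normrM normr_id ler_wpM2r//.
  - by exists M => x /hM ->; rewrite normr0 mul0r.
have dom (h : R -> R) y u : (forall x, `|h x| <= C) -> `|p u * h (y - u)| <= `|p u| * C.
  by move=> hh; rewrite normrM ler_wpM2l.
have mint (h : R -> R) y : measurable_fun setT h ->
    measurable_fun setT (fun u => p u * h (y - u)).
  by move=> mh; apply: measurable_funM => //; exact: measurable_comp_reflect.
split=> [x|s].
  have xI : `]x - 1, x + 1[%classic x by rewrite /= in_itv/=; lra.
  have := @continuity_under_integral R _ _ mu (fun y u => p u * f (y - u)) setT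
    measurableT (x - 1) (x + 1) _ _ (fun u => `|p u| * C) ig _.
  apply; last exact: mem_set.
  - move=> y _; exact: integrable_rconv bp hf.1.
  - apply: aeW => u _ y _; apply: cvgMr.
    exact: continuous_comp (@cvgB _ _ _ _ _ _ _ _ _ cvg_id (cvg_cst u)) (hf.1 _).
  - by move=> y _; apply: aeW => u _; exact: dom.
have [k hk [g [fg gf]]] := hf.2 s; exists k => //.
(* The limit [g] may be discontinuous. Being a pointwise limit of continuous functions bounded by
   [C], it is measurable and bounded by [C], as dominated convergence requires. *)
have hCg x : `|g x| <= C.
  apply: (ler_cvg_to (cvg_norm (fg x)) (cvg_cst C)).
  by near=> n; exact: hC.
have mg : measurable_fun setT g.
  apply: (@measurable_fun_cvg _ _ _ setT (fun n x => f (x + (s \o k) n))) => [n|x _];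
    last exact: fg.
  apply: continuous_measurable_fun => x.
  exact: continuous_comp (@cvgD _ _ _ _ _ _ _ _ _ cvg_id (cvg_cst _)) (hf.1 _).
exists (rconv p g); split=> x.
- apply: Rdominated_cvg ig _ _ => [n||n u|u].
  + exact: mint (raa_measurable hf).
  + exact: mint.
  + exact: dom.
  + apply: cvgMr; have := fg (x - u).
    by under eq_fun do rewrite addrAC.
- apply: Rdominated_cvg ig _ _ => [n||n u|u].
  + exact: mint.
  + exact: mint (raa_measurable hf).
  + exact: dom.
  + apply: cvgMr; have := gf (x - u).
    by under eq_fun do rewrite addrAC.
Unshelve. all: by end_near.
Qed.

End AlmostAutomorphic.

(** * Riemann sums and linear functionals of finite order *)

Section RealFunctionals.
Context {R : realType}.
Implicit Types (p q h : R -> R) (x y u a b c : R) (U : (R -> R) -> R).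
Local Notation mu := (@lebesgue_measure R).
Local Notation integrable p := (mu.-integrable setT (EFin \o p)).

Lemma integrable_itv f a b : continuous f -> mu.-integrable `[a, b] (EFin \o f).
Proof.
move=> cf; apply: continuous_compact_integrable; first exact: segment_compact.
exact: continuous_subspaceT.
Qed.

Lemma Rintegral_itv_split f a b c : continuous f -> a <= b -> b <= c ->
  \int[mu]_(x in `[a, c]) f x =
  \int[mu]_(x in `[a, b]) f x + \int[mu]_(x in `[b, c]) f x.
Proof.
move=> cf ab bc.
have := @Rintegral_itvB _ f (BLeft a) (BRight c) b (integrable_itv a c cf).
rewrite !bnd_simp => /(_ ab bc) E.
rewrite -[LHS](subrK (\int[mu]_(x in `[a, b]) f x)) E addrC; congr (_ + _).
apply: Rintegral_itv_obnd_cbnd; apply: integrableS (integrable_itv b c cf) => //.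
by apply: subset_itvr; rewrite bnd_simp.
Qed.

Lemma Rintegral_csupp f N : (forall x, N < `|x| -> f x = 0) ->
  \int[mu]_x f x = \int[mu]_(x in `[- N, N]) f x.
Proof.
move=> hN; rewrite [RHS]Rintegral_mkcond; apply: eq_Rintegral => x _.
rewrite patchE; case: ifPn => //; rewrite notin_setE/= in_itv/= => /negP.
by rewrite -ler_norml -ltNge => /hN ->.
Qed.

Lemma Rintegral_step f a b e : continuous f -> a <= b ->
  (forall x, a <= x <= b -> `|f x - f a| <= e) ->
  `|\int[mu]_(x in `[a, b]) f x - (b - a) * f a| <= (b - a) * e.
Proof.
move=> cf ab H.
have cst_int r : \int[mu]_(x in `[a, b]) r = (b - a) * r.
  rewrite Rintegral_cst// [X in fine X](mu_itvE a b)/= max_r 1?mulrC//; lra.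
have cc (r : R) : continuous (fun _ : R => r) by move=> x; exact: cvg_cst.
rewrite -!cst_int -RintegralB//; [|exact: integrable_itv..].
have cB : continuous (fun x => f x - f a) by move=> x; apply: cvgB; [exact: cf|exact: cvg_cst].
apply: le_trans (le_normr_Rintegral _ _) _ => //; first exact: integrable_itv.
apply: le_Rintegral => //.
- apply: integrable_itv => x; apply: cvg_norm; exact: cB.
- exact: integrable_itv.
Qed.

(** Subdivision points of [[-N, N]] with mesh [1 / (n + 1)]; the index [2 * N * (n + 1)] gives
    [N]. *)
Definition node (N n k : nat) : R := - N%:R + k%:R / n.+1%:R.

Lemma riemann_sum f (N n : nat) L : continuous f ->
  (forall x, N%:R < `|x| -> f x = 0) -> 0 <= L ->
  (forall x y, - N%:R <= x <= N%:R -> - N%:R <= y <= N%:R ->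
    `|f x - f y| <= L * `|x - y|) ->
  `|\int[mu]_x f x - \sum_(k < (2 * N) * n.+1) n.+1%:R^-1 * f (node N n k)|
    <= 2 * N%:R * L / n.+1%:R.
Proof.
move=> cf sf L0 Lf; rewrite (Rintegral_csupp sf).
set d : R := n.+1%:R^-1; have d0 : 0 < d by rewrite invr_gt0 ltr0n.
have nS k : node N n k.+1 = node N n k + d.
  by rewrite /node -natr1 mulrDl mul1r addrA.
have n0 k : - N%:R <= node N n k by rewrite lerDl mulr_ge0// ltW.
have nN : node N n (2 * N * n.+1) = N%:R.
  rewrite /node natrM mulfK ?pnatr_eq0// natrM; lra.
have nle k : (k <= 2 * N * n.+1)%N -> node N n k <= N%:R.
  by move=> kN; rewrite -nN /node lerD2l ler_wpM2r ?ler_nat// ltW.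
(* Each cell contributes at most its length [d] times the oscillation [L * d]; the [2 * N * (n + 1)]
   cells together give the stated constant. *)
suff H m : (m <= 2 * N * n.+1)%N ->
    `|\int[mu]_(x in `[- N%:R, node N n m]) f x
      - \sum_(k < m) d * f (node N n k)| <= m%:R * (d * (L * d)).
  have := H _ (leqnn _); rewrite nN => /le_trans; apply.
  rewrite !natrM -/d.
  have -> : 2 * N%:R * n.+1%:R * (d * (L * d)) = 2 * N%:R * L * d * (n.+1%:R * d) by ring.
  by rewrite mulfV ?pnatr_eq0// mulr1.
elim: m => [_|m IH mN].
  rewrite big_ord0 mul0r subr0 /node mul0r addr0.
  by rewrite set_itv1 Rintegral_set1 normr0.
have {}IH := IH (ltnW mN).
have mm : node N n m <= node N n m.+1 by rewrite nS lerDl ltW.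
rewrite (Rintegral_itv_split cf (n0 m) mm) big_ord_recr/=.
have : `|\int[mu]_(x in `[node N n m, node N n m.+1]) f x - d * f (node N n m)| <= d * (L * d).
  have {1 2}-> : d = node N n m.+1 - node N n m by rewrite nS; ring.
  apply: Rintegral_step => // x /andP[xm xM].
  apply: le_trans (Lf _ _ _ _) _.
  - by rewrite (le_trans (n0 m) xm)/= (le_trans xM)// nle.
  - by rewrite n0 nle// ltnW.
  - by rewrite ler_wpM2l// ger0_norm; rewrite ?nS in xM *; lra.
rewrite -natr1 mulrDl mul1r.
move: IH; rewrite !ler_norml; lra.
Qed.

Lemma test_lipschitz p : test p -> exists2 L : R, 0 <= L &
  forall x y, `|p x - p y| <= L * `|x - y|.
Proof.
move=> tp; have [sp _] := tp.
have [C hC] : exists C : R, forall x, `|derive1 p x| <= C.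
  by case: (test_bcsupp (test_derive1n 1 tp)).
exists C => [|x y]; first exact: le_trans (hC 0).
wlog xy : x y / y <= x.
  move=> H; have [/H//|/ltW/H] := leP y x.
  by rewrite distrC [`|y - x|]distrC.
have [c _ ->] := MVT_segment xy (fun z _ => rsmooth_is_derive z sp)
  (continuous_subspaceT (rsmooth_continuous sp)).
by rewrite normrM ler_wpM2r.
Qed.

Definition rlinear U := forall a p q, rD_L1 p -> rD_L1 q ->
  U (fun x => a * p x + q x) = a * U p + U q.

Definition order_le m U := exists2 C : R, 0 <= C & forall p, rD_L1 p -> `|U p| <= C * rnorm m p.

Lemma rD0 : @rD_L1 R (fun=> 0).
Proof.
apply: test_rD; split; first exact: rsmooth_cst.
by exists 0.
Qed.

Lemma rlinear0 U : rlinear U -> U (fun=> 0) = 0.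
Proof.
move=> lU; have := lU 1 _ _ rD0 rD0.
rewrite (_ : (fun x => _) = fun=> 0); last first.
  by apply/funext => x /=; rewrite mulr0 addr0.
rewrite mul1r; lra.
Qed.

Lemma rlinear_sum U (m : nat) (c : nat -> R) (g : nat -> R -> R) :
  rlinear U -> (forall k, rD_L1 (g k)) ->
  rD_L1 (fun y => \sum_(k < m) c k * g k y) /\
  U (fun y => \sum_(k < m) c k * g k y) = \sum_(k < m) c k * U (g k).
Proof.
move=> lU hg; elim: m => [|m [IH1 IH2]].
  rewrite big_ord0 (_ : (fun y => _) = fun=> 0); last first.
    by apply/funext => y; rewrite big_ord0.
  by split; [exact: rD0|exact: rlinear0].
rewrite (_ : (fun y => _) = fun y => c m * g m y + \sum_(k < m) c k * g k y); last first.
  by apply/funext => y; rewrite big_ord_recr/= addrC.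
split; first exact: rD_lin.
by rewrite lU// IH2 big_ord_recr/= addrC.
Qed.

Lemma derive1n_sum i (m : nat) (c : nat -> R) (g : nat -> R -> R) y :
  (forall k, rsmooth (g k)) ->
  rsmooth (fun y => \sum_(k < m) c k * g k y) /\
  derive1n i (fun y => \sum_(k < m) c k * g k y) y =
    \sum_(k < m) c k * derive1n i (g k) y.
Proof.
move=> hg; elim: m y => [|m IH] y.
  rewrite big_ord0 (_ : (fun y => _) = fun=> 0); last first.
    by apply/funext => z; rewrite big_ord0.
  split; first exact: rsmooth_cst.
  elim: i y => [//|i IH] y; rewrite derive1nS; have /funext -> := IH.
  exact: derive1_cst.
rewrite (_ : (fun y => _) = fun y => c m * g m y + \sum_(k < m) c k * g k y); last first.
  by apply/funext => z; rewrite big_ord_recr/= addrC.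
split; first exact: rsmooth_lin (hg m) (IH y).1.
by rewrite (derive1n_lin _ _ _ (hg m) (IH y).1) (IH y).2 big_ord_recr/= addrC.
Qed.

End RealFunctionals.

(** * Functionals and convolution *)

Section FunctionalConvolution.
Context {R : realType}.
Implicit Types (p q h eta : R -> R) (x y u a b c : R) (U : (R -> R) -> R).
Local Notation mu := (@lebesgue_measure R).
Local Notation integrable p := (mu.-integrable setT (EFin \o p)).

Lemma eq_of_dist_le a b K : (forall n : nat, `|a - b| <= K / n.+1%:R) -> a = b.
Proof.
move=> H; apply/eqP; rewrite -subr_eq0 -normr_le0; apply/ler_addgt0Pr => e e0.
rewrite add0r; have K0 : 0 <= K by have := le_trans (normr_ge0 _) (H 0%N); rewrite divr1.
apply: le_trans (H (Num.bound (K / e))) _.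
rewrite ler_pdivrMr ?ltr0n// mulrC -ler_pdivrMr// ltW//.
apply: lt_trans (archi_boundP _) _; first by rewrite divr_ge0// ltW.
by rewrite ltr_nat.
Qed.

Lemma lipschitz_mul f g x y Cf Cg Lf Lg : `|f x| <= Cf -> `|g y| <= Cg ->
  `|f x - f y| <= Lf * `|x - y| -> `|g x - g y| <= Lg * `|x - y| ->
  `|f x * g x - f y * g y| <= (Cf * Lg + Lf * Cg) * `|x - y|.
Proof.
move=> hf hg lf lg.
rewrite (_ : _ - _ = f x * (g x - g y) + (f x - f y) * g y); last by ring.
apply: le_trans (ler_normD _ _) _; rewrite [leRHS]mulrDl !normrM.
apply: lerD; first by rewrite -mulrA ler_pM.
by rewrite mulrAC ler_pM.
Qed.

Lemma csupp_nat p q : csupp p -> csupp q -> exists N : nat,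
  (forall x, N%:R < `|x| -> p x = 0) /\ (forall x, N%:R < `|x| -> q x = 0).
Proof.
move=> [M hM] [K hK]; pose D := Num.max M K.
have DN : D <= (Num.bound `|D|)%:R.
  by apply: le_trans (ler_norm _) _; rewrite ltW// archi_boundP.
exists (Num.bound `|D|); split=> x xN.
  by apply: hM; rewrite (le_lt_trans _ xN)// (le_trans _ DN)// le_max lexx.
by apply: hK; rewrite (le_lt_trans _ xN)// (le_trans _ DN)// le_max lexx orbT.
Qed.

Lemma functional_rconv U m p eta : rlinear U -> order_le m U ->
  test p -> test eta -> continuous (fun u => U (fun y => eta (y - u))) ->
  U (rconv p eta) = \int[mu]_u (p u * U (fun y => eta (y - u))).
Proof.
move=> lU [C C0 hC] tp te cQ.
pose Q u := U (fun y => eta (y - u)).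
rewrite -[RHS]/(\int[mu]_u (p u * Q u)).
have [N [pN eN]] := csupp_nat tp.2 te.2.
have bp := test_bcsupp tp.
have [Lp Lp0 lipp] := test_lipschitz tp.
have [_ [Cp hCp] _] := bp.
have Cp0 : 0 <= Cp := le_trans (normr_ge0 _) (hCp 0).
have /choice[L hL] : forall i, exists L : R, 0 <= L /\
    forall x y, `|derive1n i eta x - derive1n i eta y| <= L * `|x - y|.
  by move=> i; have [L] := test_lipschitz (test_derive1n i te); exists L.
have /choice[B hB] : forall i, exists B : R, forall x, `|derive1n i eta x| <= B.
  by move=> i; have [_ [B hB] _] := test_bcsupp (test_derive1n i te); exists B.
have B0 i : 0 <= B i := le_trans (normr_ge0 _) (hB i 0).
have eiN i x : N%:R < `|x| -> derive1n i eta x = 0 by exact: derive1n_outside.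
have N0 : 0 <= N%:R :> R by [].
have eshift i u y : `|u| <= N%:R -> 2 * N%:R < `|y| -> derive1n i eta (y - u) = 0.
  by move=> uN yN; apply: eiN; have := lerB_dist y u; lra.
have [BQ BQ0 hBQ] := continuous_bounded (- N%:R) N%:R cQ.
have rDs u : rD_L1 (fun y => eta (y - u)) by apply/test_rD/test_shift.
have lipQ : exists2 LQ : R, 0 <= LQ & forall x y, - N%:R <= x <= N%:R ->
    - N%:R <= y <= N%:R -> `|Q x - Q y| <= LQ * `|x - y|.
  (* For [x] and [y] in [[-N, N]] the difference of the two translates lives on [[-2N, 2N]], of
     length [2 * (2 * N)], and its [i]-th derivative is at most [L i * |x - y|]. *)
  exists (C * \sum_(i < m.+1) (2 * (2 * N%:R) * L i)).
    by rewrite mulr_ge0// sumr_ge0// => i _; rewrite !mulr_ge0// (hL i).1.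
  move=> x y; rewrite -!ler_norml => xN yN.
  have -> : Q x - Q y = U (fun z => -1 * eta (z - y) + eta (z - x)).
    by rewrite lU// mulN1r addrC.
  apply: le_trans (hC _ _) _; first exact: rD_lin.
  rewrite -mulrA ler_wpM2l// mulr_suml; apply: ler_sum => i _.
  have E : derive1n i (fun z => -1 * eta (z - y) + eta (z - x)) =
      fun z => -1 * derive1n i eta (z - y) + derive1n i eta (z - x).
    apply/funext => z; rewrite derive1n_lin; [|exact: (rDs _).1..].
    by rewrite !derive1n_shift//; exact: te.1.
  rewrite E -[leRHS]mulrA; apply: L1_bound.
  - by rewrite mulr_ge0// (hL i).1.
  - by rewrite mulr_ge0.
  - move=> z; rewrite mulN1r addrC; apply: le_trans ((hL i).2 _ _) _.
    by rewrite (_ : _ - _ = y - x) 1?distrC//; ring.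
  - by move=> z zN; rewrite !eshift// mulr0 addr0.
  - rewrite -E; exact: (rD_lin _ _ _).2.
have [LQ LQ0 hLQ] := lipQ.
pose S n y := \sum_(k < 2 * N * n.+1) (n.+1%:R^-1 * p (node N n k)) * eta (y - node N n k).
have S_spec n := @rlinear_sum R U (2 * N * n.+1) (fun k => n.+1%:R^-1 * p (node N n k))
  (fun k y => eta (y - node N n k)) lU (fun k => rDs _).
have rDc : rD_L1 (rconv p eta) by apply: rD_rconv => //; exact: test_rD.
have HA n : `|\int[mu]_u (p u * Q u) - U (S n)| <= 2 * N%:R * (Cp * LQ + Lp * BQ) / n.+1%:R.
  rewrite (S_spec n).2.
  under [X in _ - X]eq_bigr do rewrite -mulrA.
  apply: (@riemann_sum _ (fun u => p u * Q u)).
  - move=> u; apply: cvgM; first exact: rsmooth_continuous tp.1 u.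
    exact: cQ.
  - by move=> x /pN ->; rewrite mul0r.
  - by rewrite addr_ge0// mulr_ge0.
  - move=> x y xN yN; apply: lipschitz_mul => //; first exact: hBQ.
    exact: hLQ.
(* The length of [[-2N, 2N]] times the pointwise Riemann error over [[-N, N]], where
   [Cp * L i + Lp * B i] is a Lipschitz constant of [u -> p u * eta^(i) (z - u)] for every [z]. *)
pose K i := 2 * (2 * N%:R) * (2 * N%:R * (Cp * L i + Lp * B i)).
have HB n : `|U (rconv p eta) - U (S n)| <= C * (\sum_(i < m.+1) K i) / n.+1%:R.
  have -> : U (rconv p eta) - U (S n) = U (fun z => -1 * S n z + rconv p eta z).
    by rewrite lU// ?mulN1r 1?addrC//; exact: (S_spec n).1.
  apply: le_trans (hC _ _) _; first by apply: rD_lin => //; exact: (S_spec n).1.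
  rewrite -mulrA ler_wpM2l// mulr_suml; apply: ler_sum => i _.
  have ds z := @derive1n_sum R i (2 * N * n.+1) (fun k => n.+1%:R^-1 * p (node N n k))
    (fun k y => eta (y - node N n k)) z (fun k => (rDs _).1).
  have E : derive1n i (fun z => -1 * S n z + rconv p eta z) =
      fun z => -1 * (\sum_(k < 2 * N * n.+1) n.+1%:R^-1 *
        (p (node N n k) * derive1n i eta (z - node N n k))) + rconv p (derive1n i eta) z.
    apply/funext => z; rewrite derive1n_lin; [|exact: (S_spec n).1.1|exact: rDc.1].
    rewrite (ds z).2 derive1n_rconv//; last exact: te.1.
    congr (_ * _ + _); apply: eq_bigr => k _.
    by rewrite derive1n_shift ?mulrA//; exact: te.1.
  rewrite E -[leRHS]mulrA -[X in _ <= _ * X]mulrA; apply: L1_bound.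
  - by rewrite !mulr_ge0// addr_ge0// mulr_ge0// (hL i).1.
  - by rewrite mulr_ge0.
  - move=> z; rewrite mulN1r addrC mulrA; apply: riemann_sum.
    + move=> u; apply: cvgM; first exact: rsmooth_continuous tp.1 u.
      have cc : continuous (fun u => derive1n i eta (z - u)).
        exact/rsmooth_continuous/rsmooth_reflect/(test_derive1n i te).1.
      exact: cc.
    + by move=> x /pN ->; rewrite mul0r.
    + by rewrite addr_ge0// mulr_ge0// (hL i).1.
    + move=> x y _ _; apply: (@lipschitz_mul p (fun u => derive1n i eta (z - u))) => //.
      apply: le_trans ((hL i).2 _ _) _.
      by rewrite (_ : _ - _ = y - x) 1?distrC//; ring.
  - move=> z zN.
    have E0 u : p u * derive1n i eta (z - u) = 0.
      have [uN|/pN ->] := leP `|u| N%:R; last by rewrite mul0r.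
      by rewrite eshift// mulr0.
    rewrite /rconv; under eq_Rintegral do rewrite E0.
    rewrite big1 => [|k _]; last by rewrite E0 mulr0.
    by rewrite mulr0 add0r Rintegral_cst// mul0r.
  - rewrite -E; apply: (rD_lin _ _ _).2 => //; exact: (S_spec n).1.
apply: (@eq_of_dist_le _ _ (2 * N%:R * (Cp * LQ + Lp * BQ) + C * \sum_(i < m.+1) K i)) => n.
rewrite mulrDl; have := HA n; have := HB n; rewrite !ler_norml.
move: (_ / _) (_ / _) (U (S n)) (U (rconv _ _)) (\int[mu]_u _) => a1 a2 b1 b2 b3; lra.
Qed.

End FunctionalConvolution.

(** * The parametrix *)

Section Parametrix.
Context {R : realType}.
Implicit Types (p q h : R -> R) (x y u a b c : R) (U : (R -> R) -> R).
Local Notation mu := (@lebesgue_measure R).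
Local Notation integrable p := (mu.-integrable setT (EFin \o p)).

(* The jump at [0] is where the Dirac mass comes from. *)
Definition cutoff u : R := if u <= 0 then 1 - step (0 - u) else 0.

(** The smooth part of the derivative of [cutoff]: as a distribution, that derivative is [rdstep]
    minus the Dirac mass at 0. *)
Definition rdstep u : R := derive1 step (0 - u).

(** It lives on [[0, 1]]: the reflected function [u -> cutoff_seq n (0 - u)] is the one that
    approximates [cutoff], so that convolving [U] with [cutoff_seq n] itself gives the approximate
    density. The [+ 0] matches [rsmooth_aff]. *)
Definition cutoff_seq (n : nat) u : R := (1 - step u) * step (n.+1%:R * u + 0).

Lemma rsmooth_1step : rsmooth (fun u : R => 1 - step u).
Proof.
rewrite (_ : (fun u => _) = fun u => -1 * step u + 1).
  exact (rsmooth_lin (-1) rsmooth_step (rsmooth_cst 1)).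
by apply/funext => u; rewrite mulN1r addrC.
Qed.

Lemma dstep_outside x : x < 0 \/ 1 < x -> derive1 (@step R) x = 0.
Proof.
move=> [x0|x1]; apply: derive1_val.
  apply: (@near_eq_is_derive _ _ _ (cst 0)); near=> y.
  by rewrite step_le0// ltW//; near: y; exact: lt_nbhsl.
apply: (@near_eq_is_derive _ _ _ (cst (1 : R))); near=> y.
by rewrite step_ge1// ltW//; near: y; exact: lt_nbhsr.
Unshelve. all: by end_near.
Qed.

Lemma test_dstep : test (derive1 (@step R)).
Proof.
split; first exact/rsmooth_derive1/rsmooth_step.
by exists 1 => x; rewrite lter_normr => /orP[x1|x1]; apply: dstep_outside; lra.
Qed.

Lemma test_rdstep : test rdstep.
Proof. exact/test_reflect/test_dstep. Qed.

Lemma cutoff_bound u : 0 <= cutoff u <= 1.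
Proof.
rewrite /cutoff; case: ifP => _; last by rewrite lexx ler01.
by have := step_ge0 (0 - u); have := step_le1 (0 - u); lra.
Qed.

Lemma cutoff_outside u : 1 < `|u| -> cutoff u = 0.
Proof.
rewrite /cutoff lter_normr => /orP[u1|u1]; case: ifP => // u0; first lra.
by rewrite step_ge1 ?subrr//; lra.
Qed.

Lemma bcsupp_cutoff : bcsupp cutoff.
Proof.
split; last by exists 1 => u /cutoff_outside.
  rewrite (_ : cutoff = fun u => (1 - step (0 - u)) * \1_(`]-oo, 0%R]) u).
    apply: measurable_funM; last exact: measurable_indic.
    apply: continuous_measurable_fun; apply: rsmooth_continuous.
    exact (rsmooth_reflect 0 rsmooth_1step).
  apply/funext => u; rewrite /cutoff indicE; case: ifPn => u0.
    by rewrite mem_set ?mulr1//= in_itv.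
  by rewrite memNset ?mulr0//= in_itv/=; apply/negP.
exists 1 => u; have := cutoff_bound u; rewrite ler_norml; lra.
Qed.

Lemma test_cutoff_seq n : test (cutoff_seq n).
Proof.
split.
  apply: rsmoothM; first exact: rsmooth_1step.
  exact/rsmooth_aff/rsmooth_step.
exists 1 => x; rewrite /cutoff_seq lter_normr => /orP[x1|x1].
  by rewrite step_ge1 ?subrr ?mul0r// ltW.
rewrite (@step_le0 _ (_ + 0)) ?mulr0// addr0 mulr_ge0_le0//; lra.
Qed.

(** The two functions differ by at most 1, and only between [- 1 / (n + 1)] and 0; the 2 comes from
    [L1_bound], which works with symmetric intervals. *)
Lemma L1_cutoff_seq n : L1 (fun u => cutoff u - cutoff_seq n (0 - u)) <= 2 / n.+1%:R.
Proof.
have n0 : (0 : R) < n.+1%:R by rewrite ltr0n.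
rewrite -[leRHS]mulr1; apply: L1_bound => //.
- move=> u; rewrite /cutoff /cutoff_seq.
  set a := step (0 - u); set b := step _.
  have a0 : 0 <= a := step_ge0 _.
  have a1 : a <= 1 := step_le1 _.
  have b0 : 0 <= b := step_ge0 _.
  have b1 : b <= 1 := step_le1 _.
  have c0 : 0 <= (1 - a) * b by rewrite mulr_ge0//; lra.
  have c1 : (1 - a) * b <= 1 - a by rewrite ler_piMr//; lra.
  by rewrite ler_norml; case: ifP => _; lra.
- move=> u; rewrite lter_normr /cutoff /cutoff_seq => /orP[u1|u1].
    have u0 : 0 < u by apply: le_lt_trans u1; rewrite invr_ge0 ltW.
    rewrite leNgt u0/= (@step_le0 _ (_ + 0)) ?mulr0 ?subrr//.
    by rewrite addr0 mulr_ge0_le0 ?ltW//; lra.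
  have u0 : u <= 0 by rewrite -oppr_ge0 (le_trans _ (ltW u1))// invr_ge0 ltW.
  rewrite u0 (@step_ge1 _ (_ + 0)) ?mulr1 ?subrr//.
  by rewrite addr0 mulrC -ler_pdivrMr// div1r ltW// sub0r.
- rewrite (_ : (fun u => _) = fun u => -1 * cutoff_seq n (0 - u) + cutoff u).
    apply: integrable_lin; apply: integrable_bcsupp; last exact: bcsupp_cutoff.
    exact/test_bcsupp/test_reflect/test_cutoff_seq.
  by apply/funext => u; rewrite mulN1r addrC.
Qed.

(** Integration by parts on [[-1, 0]], where [cutoff] coincides with the smooth function [F]. The
    boundary term at 0 is the Dirac mass; the one at -1 vanishes because [step 1 = 1]. *)
Lemma rconv_cutoff_derive1 p : rsmooth p ->
  rconv cutoff (derive1 p) = fun y => -1 * p y + rconv rdstep p y.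
Proof.
move=> sp; apply/funext => y.
pose F u : R := 1 - step (0 - u); pose G u : R := -1 * p (y - u).
have sF : rsmooth F by exact: (rsmooth_reflect 0 rsmooth_1step).
have sG : rsmooth G.
  rewrite (_ : G = fun u => -1 * p (y - u) + 0).
    exact (rsmooth_lin (-1) (rsmooth_reflect y sp) (rsmooth_cst 0)).
  by apply/funext => u; rewrite addr0.
have dF : derive1 F = rdstep.
  apply/funext => u; have := @derive1n_reflect _ _ 0 1 u rsmooth_1step.
  rewrite !derive1n1 expr1 => ->; rewrite (_ : (fun u => 1 - step u) =
    fun u => -1 * step u + 1); last by apply/funext => z; rewrite mulN1r addrC.
  rewrite -(derive1n1 (fun u => _ + _)).
  rewrite (derive1n_lin (-1) 1 _ rsmooth_step (rsmooth_cst 1)) !derive1n1.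
  by rewrite derive1_cst addr0 mulrA mulrNN !mul1r.
have dG : derive1 G = fun u => derive1 p (y - u).
  apply/funext => u; rewrite (_ : G = fun u => -1 * p (y - u) + 0); last first.
    by apply/funext => z; rewrite addr0.
  rewrite -derive1n1.
  rewrite (derive1n_lin (-1) 1 u (rsmooth_reflect y sp) (rsmooth_cst 0)).
  rewrite (derive1n_reflect y 1 u sp) !derive1n1 derive1_cst addr0.
  by rewrite expr1 mulrA mulrNN !mul1r.
have LR (f : R -> R) : rsmooth f -> derivable_oo_LRcontinuous f (-1) 0.
  move=> sf; split=> [x _||].
  - exact: rsmooth_derivable.
  - exact/cvg_at_right_filter/rsmooth_continuous.
  - exact/cvg_at_left_filter/rsmooth_continuous.
have ct (f : R -> R) : rsmooth f -> {within `[-1, 0], continuous f}.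
  by move=> sf; exact/continuous_subspaceT/rsmooth_continuous.
have := @Rintegration_by_parts R F G (derive1 F) (derive1 G) (-1) 0 _
   (ct _ (rsmooth_derive1 sF)) (LR _ sF) (fun _ _ => erefl)
   (ct _ (rsmooth_derive1 sG)) (LR _ sG) (fun _ _ => erefl).
rewrite ltrN10 => /(_ isT) E.
have -> : rconv cutoff (derive1 p) y = \int[mu]_(x in `[-1, 0]) (F x * derive1 G x).
  rewrite [RHS]Rintegral_mkcond; apply: eq_Rintegral => u _.
  rewrite patchE; case: ifPn => [/set_mem|].
    by rewrite /= in_itv/= dG /cutoff => /andP[_ ->].
  rewrite notin_setE/= in_itv/= => /negP; rewrite negb_and -!ltNge => /orP[u1|u0].
    by rewrite cutoff_outside ?mul0r// lter_normr; apply/orP; right; lra.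
  by rewrite /cutoff leNgt u0 mul0r.
have F0 : F 0 = 1 by rewrite /F step_le0 subr0.
have F1 : F (-1) = 0 by rewrite /F step_ge1 ?subrr// sub0r opprK.
have G0 : G 0 = -1 * p y by rewrite /G subr0.
rewrite E F0 F1 G0 mul0r subr0 mul1r.
congr (_ + _).
have -> : rconv rdstep p y = \int[mu]_(x in `[-1, 0]) (rdstep x * p (y - x)).
  rewrite [RHS]Rintegral_mkcond; apply: eq_Rintegral => u _.
  rewrite patchE; case: ifPn => //.
  rewrite notin_setE/= in_itv/= => /negP; rewrite negb_and -!ltNge => u1.
  by rewrite /rdstep dstep_outside ?mul0r//; case/orP: u1 => ?; lra.
rewrite dF -[LHS]mulN1r -RintegralZl//; last first.
  apply: integrable_itv => u; apply: cvgM; last exact: (rsmooth_continuous sG).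
  exact/rsmooth_continuous/test_rdstep.1.
by apply: eq_Rintegral => u _; rewrite /G; ring.
Qed.

Definition translates_raa U := forall p, test p -> raa (fun x => U (fun y => p (x - y))).

(* [U] is the sum of the [f j]^(j), [j <= k], as a distribution. *)
Definition representable k U (f : nat -> R -> R) := forall p, test p ->
  U p = \sum_(j < k.+1) (-1) ^+ j * \int[mu]_x (f j x * derive1n j p x).

(** The function [U * h] is the density of the functional obtained by convolving the argument of [U]
    with the reflection of [h]. *)
Lemma functional_rconv_reflect U m h p : rlinear U -> order_le m U ->
  translates_raa U -> test h -> test p ->
  U (rconv (fun u => h (0 - u)) p) = \int[mu]_u (U (fun y => h (u - y)) * p u).
Proof.
move=> lU oU aU th tp.
have E u : (fun y => h (0 - (y - u))) = fun y => h (u - y).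
  by apply/funext => y; rewrite sub0r opprB.
rewrite rconvC; [|exact/test_bcsupp/test_reflect|exact: rsmooth_continuous tp.1].
rewrite (functional_rconv lU oU tp (test_reflect 0 th)).
  by apply: eq_Rintegral => u _; rewrite E mulrC.
rewrite (_ : (fun u => _) = fun u => U (fun y => h (u - y))); first exact: (aU _ th).1.
by apply/funext => u; rewrite E.
Qed.

Section Primitive.
Variables (U : (R -> R) -> R) (m : nat).
Hypotheses (lU : rlinear U) (oU : order_le m U) (aU : translates_raa U).

(** A primitive of [U] up to a regular distribution: the derivative of [S] is
    [p -> - S (derive1 p)], and [primitive_decomposition] compares it with [U]. *)
Let S p := U (rconv cutoff p).

Lemma rlinear_primitive : rlinear S.
Proof.
move=> a p q dp dq; rewrite /S rconv_linr; first last.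
- exact: rsmooth_continuous dq.1.
- exact: rsmooth_continuous dp.1.
- exact: bcsupp_cutoff.
by rewrite lU//; apply: rD_rconv => //; exact: bcsupp_cutoff.
Qed.

(** Convolving [S] with [p] amounts to convolving [U] with the test function [z -> rconv cutoff (fun
    x => p (0 - x)) (0 - z)]. *)
Lemma translates_raa_primitive : translates_raa S.
Proof.
move=> p tp; have := aU (test_reflect 0 (test_rconv bcsupp_cutoff (test_reflect 0 tp))).
rewrite (_ : (fun x => _) = fun x => S (fun y => p (x - y)))//.
apply/funext => x; congr (U _); apply/funext => y.
by apply: eq_Rintegral => u _; congr (_ * p _); ring.
Qed.

Lemma primitive_decomposition p : test p ->
  U p = (\int[mu]_u (U (fun y => derive1 step (u - y)) * p u)) - S (derive1 p).
Proof.
move=> tp; have dp := test_rD tp.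
have bb := test_bcsupp test_rdstep.
rewrite -(functional_rconv_reflect lU oU aU test_dstep tp) /S.
rewrite (rconv_cutoff_derive1 tp.1) lU//; last exact: rD_rconv.
by rewrite mulN1r opprD opprK addrCA subrr addr0.
Qed.

End Primitive.

(** The term without derivative is controlled by [L1 cutoff]. The derivative of order [i + 1] of
    [rconv cutoff p] is [- p^(i) + rconv rdstep p^(i)], which involves only [p^(i)] and costs the
    factor [1 + L1 rdstep]. *)
Lemma order_le_primitive U m : order_le m.+1 U ->
  order_le m (fun p => U (rconv cutoff p)).
Proof.
move=> [C C0 hC]; exists (C * (L1 cutoff + (1 + L1 rdstep))).
  by rewrite mulr_ge0// !addr_ge0 ?L1_ge0.
move=> p dp; apply: le_trans (hC _ (rD_rconv bcsupp_cutoff dp)) _.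
rewrite -mulrA ler_wpM2l// /rnorm big_ord_recl mulrDl; apply: lerD.
  apply: le_trans (L1_rconv 0 bcsupp_cutoff dp) _.
  rewrite ler_wpM2l ?L1_ge0// big_ord_recl lerDl.
  by apply: sumr_ge0 => i _; exact: L1_ge0.
rewrite mulr_sumr; apply: ler_sum => i _; rewrite lift0.
rewrite derive1n_rconv; [|exact: bcsupp_cutoff|exact: dp.1].
have si := rsmooth_derive1n i dp.1.
rewrite derive1nS rconv_cutoff_derive1//.
have bb := test_bcsupp test_rdstep.
have [ic lc] := rconv_L1 bb si (dp.2 i).
apply: le_trans (L1_lin _ (dp.2 i) ic) _.
by rewrite normrN1 mulrDl lerD2l.
Qed.

Lemma representable_step U m k (f : nat -> R -> R) :
  rlinear U -> order_le m U -> translates_raa U ->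
  representable k (fun p => U (rconv cutoff p)) f ->
  representable k.+1 U (fun j => if j is i.+1 then f i
    else fun u => U (fun y => derive1 step (u - y))).
Proof.
move=> lU oU aU hf p tp; rewrite (primitive_decomposition lU oU aU tp).
rewrite big_ord_recl expr0 mul1r; congr (_ + _).
rewrite (hf _ (test_derive1n 1 tp)) -sumrN; apply: eq_bigr => i _.
by rewrite lift0 exprS mulN1r mulNr -derive1Sn.
Qed.

End Parametrix.

(** * The real case *)

Section Representation.
Context {R : realType}.
Implicit Types (p q h : R -> R) (x y u a b c : R) (U : (R -> R) -> R).
Local Notation mu := (@lebesgue_measure R).
Local Notation integrable p := (mu.-integrable setT (EFin \o p)).

Lemma L1_reflect p c : integrable p -> L1 (fun y => p (c - y)) = L1 p.
Proof. by move=> ip; apply: (@Rintegral_reflect _ (fun x => `|p x|)); exact: normr_integrable. Qed.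

Lemma test_integrable_raa f p : raa f -> test p -> integrable (fun x => f x * p x).
Proof.
move=> rf [sp [M pM]]; have [C hC] := raa_bounded rf; apply: integrable_bcsupp.
apply: continuous_bcsupp => [x|].
  by apply: cvgM; [exact: rf.1|exact: rsmooth_continuous].
by exists M => x /pM ->; rewrite mulr0.
Qed.

(** At order 0 the functional is controlled by the L^1 norm alone, which reflection and translation
    preserve; hence the functions [F n] are Cauchy uniformly in [x]. *)
Lemma representable_order0 U : rlinear U -> order_le 0 U -> translates_raa U ->
  exists2 F : R -> R, raa F & representable 0 (fun p => U (rconv cutoff p)) (fun=> F).
Proof.
move=> lU oU aU; have [C C0 hC] := oU.
have hC0 p : rD_L1 p -> `|U p| <= C * L1 p.
  by move=> /hC; rewrite /rnorm big_ord_recl big_ord0 addr0.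
pose D n u : R := cutoff u - cutoff_seq n (0 - u).
have ta n := test_cutoff_seq n : test (@cutoff_seq R n).
have DE n : D n = fun u => -1 * cutoff_seq n (0 - u) + cutoff u.
  by apply/funext => u; rewrite mulN1r addrC.
have bD n : bcsupp (D n).
  rewrite DE; apply: bcsupp_lin; last exact: bcsupp_cutoff.
  exact/test_bcsupp/test_reflect.
pose F n x := U (fun y => cutoff_seq n (x - y)).
have rF n : raa (F n) by exact: aU.
have FF n l x : (n <= l)%N -> `|F n x - F l x| <= 4 * C / n.+1%:R.
  move=> nl.
  have dr k : rD_L1 (fun y => cutoff_seq k (x - y)) by exact/test_rD/test_reflect.
  have -> : F n x - F l x = U (fun y => -1 * cutoff_seq l (x - y) + cutoff_seq n (x - y)).
    by rewrite lU// mulN1r addrC.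
  apply: le_trans (hC0 _ (rD_lin (-1) (dr l) (dr n))) _.
  rewrite (_ : 4 * C / _ = C * (4 / n.+1%:R)); last by ring.
  rewrite ler_wpM2l//.
  have itv : integrable (fun z => -1 * cutoff_seq l z + cutoff_seq n z).
    by apply: integrable_lin; exact/integrable_bcsupp/test_bcsupp.
  rewrite (@L1_reflect (fun z => -1 * cutoff_seq l z + cutoff_seq n z) x itv).
  rewrite -(@L1_reflect (fun z => -1 * cutoff_seq l z + cutoff_seq n z) 0 itv).
  (* The discontinuous [cutoff] cancels between [D n] and [D l]; each is at most [2 / (n + 1)] in
     L^1 since [n <= l], whence the constant 4. *)
  rewrite (_ : (fun y => _) = fun u => -1 * D n u + D l u); last first.
    by apply/funext => u; rewrite /D; ring.
  apply: le_trans (L1_lin _ (integrable_bcsupp (bD n)) (integrable_bcsupp (bD l))) _.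
  rewrite normrN1 mul1r; apply: le_trans (lerD (L1_cutoff_seq n) (L1_cutoff_seq l)) _.
  have : 2 / l.+1%:R <= 2 / n.+1%:R :> R.
    by rewrite ler_pM2l// lef_pV2 ?posrE ?ltr0n// ler_nat.
  rewrite (_ : 4 / n.+1%:R = 2 / n.+1%:R + 2 / n.+1%:R :> R); last by ring.
  by rewrite lerD2l.
have e0 : (4 * C / n.+1%:R) @[n --> \oo] --> (0 : R).
  rewrite -(mulr0 (4 * C)); apply: cvgMr; exact: cvg_harmonic.
have Fc x : cvgn (fun n => F n x).
  apply/cauchy_cvgP/cauchy_exP => d d0.
  have /cvgrPdist_lt/(_ d d0)[N _ /(_ N (leqnn N))] := e0.
  rewrite sub0r normrN => /(le_lt_trans (ler_norm _)) Nd.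
  exists (F N x).
  suff : \forall n \near \oo, ball (F N x) d (F n x) by [].
  exists N => // n /= Nn; rewrite -ball_normE/=.
  exact: le_lt_trans (FF _ _ _ Nn) Nd.
pose G x := lim (F n x @[n --> \oo]).
have FG n x : `|F n x - G x| <= 4 * C / n.+1%:R.
  have H : `|F n x - F l x| @[l --> \oo] --> `|F n x - G x|.
    by apply: cvg_norm; apply: cvgB; [exact: cvg_cst|exact: Fc].
  apply: (ler_cvg_to H (cvg_cst (4 * C / n.+1%:R))).
  by exists n => // l /= nl; exact: FF.
have rG : raa G by exact: raa_uniform_lim rF e0 FG.
exists G => // p tp; rewrite big_ord_recl big_ord0 addr0 expr0 mul1r derive1n0.
have dp := test_rD tp.
apply: (@eq_of_dist_le _ _ _ (C * 2 * L1 p + 4 * C * L1 p)) => n.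
(* [U (rconv A p)] is the intermediate term: it is near [U (rconv cutoff p)] because [A] is near
   [cutoff] in L^1, and it equals the integral of [F n] against [p], with [F n] uniformly near
   [G]. *)
pose A := fun u => cutoff_seq n (0 - u) : R.
have bA : bcsupp A by exact/test_bcsupp/test_reflect.
have H1 : `|U (rconv cutoff p) - U (rconv A p)| <= C * 2 * L1 p / n.+1%:R.
  have -> : U (rconv cutoff p) - U (rconv A p) = U (rconv (D n) p).
    rewrite DE rconv_linl//; [|exact: bcsupp_cutoff|exact: rsmooth_continuous tp.1].
    by rewrite (lU _ _ _ (rD_rconv bA dp) (rD_rconv bcsupp_cutoff dp)) mulN1r addrC.
  apply: le_trans (hC0 _ (rD_rconv (bD n) dp)) _.
  rewrite (_ : C * 2 * L1 p / _ = C * (2 / n.+1%:R * L1 p)); last by ring.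
  rewrite ler_wpM2l//; apply: le_trans (L1_rconv 0 (bD n) dp) _.
  by rewrite ler_wpM2r ?L1_ge0//; exact: L1_cutoff_seq.
have H2 : `|U (rconv A p) - \int[mu]_x (G x * p x)| <= 4 * C * L1 p / n.+1%:R.
  rewrite (functional_rconv_reflect lU oU aU (ta n) tp) -/(F n _).
  have iF f : raa f -> integrable (fun x => f x * p x) by move/test_integrable_raa; exact.
  rewrite -RintegralB//; [|exact: iF (rF n)|exact: iF].
  have iB : integrable (fun x => F n x * p x - G x * p x).
    rewrite (_ : (fun x => _) = fun x => -1 * (G x * p x) + F n x * p x).
      apply: integrable_lin; [exact: iF|exact: iF (rF n)].
    by apply/funext => x; rewrite mulN1r addrC.
  apply: le_trans (le_normr_Rintegral _ iB) _ => //.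
  rewrite (_ : 4 * C * L1 p / _ = 4 * C / n.+1%:R * L1 p); last by ring.
  have ip := normr_integrable (dp.2 0%N).
  rewrite /L1 -RintegralZl//; apply: le_Rintegral => //.
  - exact: normr_integrable.
  - rewrite (_ : EFin \o _ = (fun x => (4 * C / n.+1%:R)%:E * (EFin \o (fun x => `|p x|%R)) x)%E)//.
    exact: integrableZl.
  - by move=> x _; rewrite -mulrBl normrM ler_wpM2r.
rewrite mulrDl; move: H1 H2; rewrite !ler_norml.
move: (_ / _) (_ / _) (U (rconv A p)) (U (rconv _ _)) (\int[mu]_u _) => a1 a2 b1 b2 b3; lra.
Qed.

(** Each use of the parametrix adds one derivative: [m] of them bring the order down to 0, and one
    more turns a functional of order 0 into a regular distribution. *)
Lemma representation U m : rlinear U -> order_le m U -> translates_raa U ->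
  exists2 f : nat -> R -> R, forall j, raa (f j) & representable m.+1 U f.
Proof.
elim: m U => [|m IH] U lU oU aU.
  have [F rF hF] := representable_order0 lU oU aU.
  eexists; last exact: representable_step lU oU aU hF.
  by case=> [|j]; [exact: aU test_dstep|].
have [f rf hf] := IH _ (rlinear_primitive lU) (order_le_primitive oU)
  (translates_raa_primitive aU).
eexists; last exact: representable_step lU oU aU hf.
by case=> [|j]; [exact: aU test_dstep|].
Qed.

Lemma raa_sum (k : nat) (f : nat -> R -> R) : (forall j, raa (f j)) ->
  raa (fun x => \sum_(j < k) f j x).
Proof.
move=> rf; elim: k => [|k IH].
  rewrite (_ : (fun x => _) = fun=> 0); first exact: raa0.
  by apply/funext => x; rewrite big_ord0.
rewrite (_ : (fun x => _) = fun x => 1 * f k x + \sum_(j < k) f j x).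
  exact: raa_lin.
by apply/funext => x; rewrite big_ord_recr/= mul1r addrC.
Qed.

(** The sign of the distributional derivative cancels the one produced by reflecting [p], leaving
    the convolution of [f] with the [n]-th derivative of [p]. *)
Lemma raa_Rintegral_translate f p n : raa f -> test p ->
  raa (fun x => (-1) ^+ n * \int[mu]_y (f y * derive1n n (fun y => p (x - y)) y)).
Proof.
move=> rf tp; have tn := test_derive1n n tp.
rewrite (_ : (fun x => _) = rconv (derive1n n p) f); first exact: raa_rconv.
apply/funext => x.
rewrite rconvC; [|exact: test_bcsupp|exact: rf.1].
rewrite /rconv -RintegralZl//; last first.
  by apply: test_integrable_raa => //; exact/test_derive1n/test_reflect.
apply: eq_Rintegral => y _.
by rewrite (derive1n_reflect _ _ _ tp.1) [f y * _]mulrCA signrMK.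
Qed.

Lemma representable_translates U k (f : nat -> R -> R) :
  (forall j, raa (f j)) -> representable k U f -> translates_raa U.
Proof.
move=> rf hf p tp.
rewrite (_ : (fun x => _) = fun x => \sum_(j < k.+1)
    ((-1) ^+ j * \int[mu]_y (f j y * derive1n j (fun y => p (x - y)) y))).
  apply: (@raa_sum k.+1
    (fun j x => (-1) ^+ j * \int[mu]_y (f j y * derive1n j (fun y => p (x - y)) y))).
  by move=> j; exact: raa_Rintegral_translate.
by apply/funext => x; rewrite (hf _ (test_reflect x tp)).
Qed.

End Representation.

(** * The complex case *)

Local Open Scope ring_scope.
Local Open Scope complex_scope.

Section ComplexReduction.
Context {R : realType}.
Implicit Types (p q : R -> R) (f phi psi : R -> R[i]) (x y : R) (z : R[i]).
Local Notation mu := (@lebesgue_measure R).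
Local Notation integrable p := (mu.-integrable setT (EFin \o p)).
Local Notation normc := ComplexField.Normc.normc.

Definition re f x := complex.Re (f x).
Definition im f x := complex.Im (f x).

Lemma cderivenE n f : cderiven n f =
  fun x => derive1n n (re f) x +i* derive1n n (im f) x.
Proof.
elim: n => [|n IH]; first by apply/funext => x; rewrite /cderiven/= /re /im; case: (f x).
by rewrite /cderiven iterS -/(cderiven n f) IH /cderive; apply/funext => x /=.
Qed.

Lemma smoothP f : smooth f <-> rsmooth (re f) /\ rsmooth (im f).
Proof.
split=> [sf|[sr si] n x].
  by split; split=> n x; have := sf n x; rewrite cderivenE; case=> dr di;
    [exact dr|exact di].
by rewrite cderivenE; split; exact: derivable_derive1n.
Qed.

Lemma csupp_reim f : (csupp (re f) /\ csupp (im f)) <->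
  exists M : R, forall x, M < `|x| -> f x = 0.
Proof.
split=> [[[M hM] [N hN]]|[M hM]].
  exists (Num.max M N) => x; rewrite gt_max => /andP[/hM + /hN].
  by rewrite /re /im; case: (f x) => a b /= -> ->.
by split; exists M => x /hM; rewrite /re /im => ->.
Qed.

Lemma compact_suppP f : compact (closure [set x : R | f x != 0]) <->
  exists M : R, forall x, M < `|x| -> f x = 0.
Proof.
split=> [cf|[M hM]].
  have [M [Mr hM]] := compact_bounded cf.
  exists (M + 1) => x xM; apply/eqP/negPn/negP => fx0.
  have : `|x| <= M + 1.
    by apply: (hM (M + 1)); [rewrite ltrDl|exact: subset_closure].
  by rewrite leNgt xM.
apply: (@subclosed_compact _ _ `[- M, M]).
- exact: closed_closure.
- exact: segment_compact.
have cI : closed (`[- M, M]%classic : set R) by exact: interval_closed.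
rewrite (proj1 (closure_id _) cI).
apply: closure_subset => x /= /eqP fx0; rewrite in_itv/= -ler_norml leNgt.
by apply/negP => /hM.
Qed.

Lemma test_functionP f : test_function f <-> test (re f) /\ test (im f).
Proof.
rewrite /test_function smoothP compact_suppP -csupp_reim; split.
  by move=> [[? ?] [? ?]].
by move=> [[? ?] [? ?]].
Qed.

Lemma D_L1P f : D_L1 f <-> rD_L1 (re f) /\ rD_L1 (im f).
Proof.
rewrite /D_L1 smoothP; split=> [[[sr si] H]|[[sr ir] [si ii]]].
  by split; split=> // n; have := H n; rewrite cderivenE => -[].
by split=> // n; rewrite cderivenE; split; [exact: ir|exact: ii].
Qed.

Lemma norm_normc z : `|z| = (normc z)%:C.
Proof. by rewrite normc_def; case: z. Qed.

Lemma normc_ge_Re z : `|complex.Re z| <= normc z.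
Proof. by case: z => a b /=; rewrite -sqrtr_sqr ler_wsqrtr// lerDl sqr_ge0. Qed.

Lemma normc_ge_Im z : `|complex.Im z| <= normc z.
Proof. by case: z => a b /=; rewrite -sqrtr_sqr ler_wsqrtr// lerDr sqr_ge0. Qed.

Lemma normc_le_sum z : normc z <= `|complex.Re z| + `|complex.Im z|.
Proof.
case: z => a b /=; rewrite -[leRHS]ger0_norm ?addr_ge0// -sqrtr_sqr ler_wsqrtr//.
rewrite sqrrD !real_normK ?num_real// addrAC lerDl mulrn_wge0// mulr_ge0//.
Qed.

Lemma cvg_complexP (T : Type) (F : set_system T) {FF : Filter F} (f : T -> R[i]) (l : R[i]) :
  ((f x : R[i]^o) @[x --> F] --> (l : R[i]^o)) <->
  (complex.Re (f x) @[x --> F] --> complex.Re l) /\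
  (complex.Im (f x) @[x --> F] --> complex.Im l).
Proof.
split=> [/cvgrPdist_lt H|[/cvgrPdist_lt Hr /cvgrPdist_lt Hi]].
  have K e : 0 < e -> \forall x \near F, normc (l - f x) < e.
    move=> e0; have := H e%:C; rewrite ltcR => /(_ e0).
    by apply: filterS => x; rewrite norm_normc ltcR.
  split; apply/cvgrPdist_lt => e /K; apply: filterS => x; apply: le_lt_trans.
    by rewrite -raddfB; exact: normc_ge_Re.
  by rewrite -raddfB; exact: normc_ge_Im.
(* In the order of [R[i]], [0 < e] forces [e] to be real, so [complex.Re e] serves as the radius. *)
apply/cvgrPdist_lt => e; rewrite ltcE/= => /andP[/eqP ei e0].
have e2 : 0 < complex.Re e / 2 by rewrite divr_gt0.
near=> x.
have h1 : `|complex.Re l - complex.Re (f x)| < complex.Re e / 2 by near: x; exact: Hr.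
have h2 : `|complex.Im l - complex.Im (f x)| < complex.Re e / 2 by near: x; exact: Hi.
rewrite norm_normc ltcE/= ei eqxx/=.
apply: le_lt_trans (normc_le_sum _) _; rewrite !raddfB/=; lra.
Unshelve. all: by end_near.
Qed.

Lemma almost_automorphicP f : almost_automorphic f <-> raa (re f) /\ raa (im f).
Proof.
split=> [[cf hf]|[rr ri]].
  split; split.
  - by move=> x; exact: ((cvg_complexP _ _).1 (cf x)).1.
  - move=> s; have [k hk [g [fg gf]]] := hf s; exists k => //; exists (re g).
    split=> x; first exact: ((cvg_complexP _ _).1 (fg x)).1.
    exact: ((cvg_complexP _ _).1 (gf x)).1.
  - by move=> x; exact: ((cvg_complexP _ _).1 (cf x)).2.
  - move=> s; have [k hk [g [fg gf]]] := hf s; exists k => //; exists (im g).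
    split=> x; first exact: ((cvg_complexP _ _).1 (fg x)).2.
    exact: ((cvg_complexP _ _).1 (gf x)).2.
split=> [x|s]; first by apply/cvg_complexP; split; [exact: rr.1|exact: ri.1].
have [k hk [g1 [g2 [[a1 b1] [a2 b2]]]]] := raa_common2 s rr ri.
exists k => //; exists (fun x => g1 x +i* g2 x).
split=> x; apply/cvg_complexP; split => /=.
- exact: a1.
- exact: a2.
- exact: b1.
- exact: b2.
Qed.

Definition cembed p : R -> R[i] := fun x => p x +i* 0.

Lemma D_L1_cembed p : rD_L1 p -> D_L1 (cembed p).
Proof. by move=> dp; apply/D_L1P; split=> //; exact: rD0. Qed.

Lemma test_cembed p : test p -> test_function (cembed p).
Proof.
move=> tp; apply/test_functionP; split=> //; split; first exact: rsmooth_cst.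
by exists 0.
Qed.

Lemma norm_m1_cembed m p : norm_m1 m (cembed p) = rnorm m p.
Proof.
rewrite /norm_m1 big_mkord; apply: eq_bigr => i _; rewrite /norm_L1 cderivenE.
apply: eq_Rintegral => x _ /=.
rewrite (_ : derive1n i (im (cembed p)) x = 0) ?expr0n ?addr0 ?sqrtr_sqr//=.
(* The bound -1 turns the outside of the support into the whole line. *)
by rewrite (@derive1n_outside _ _ (-1))// (lt_le_trans _ (normr_ge0 x))// ltrN10.
Qed.

Section FunctionalParts.
Variable T : (R -> R[i]) -> R[i].
Hypothesis hT : bounded_distribution T.

Definition Tre p := complex.Re (T (cembed p)).
Definition Tim p := complex.Im (T (cembed p)).

(** Complex linearity gives [T (a + i b) = T a + i T b], so [T] is determined by its values on real
    functions. *)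
Lemma T_reim phi : D_L1 phi -> T phi =
  (Tre (re phi) - Tim (im phi)) +i* (Tim (re phi) + Tre (im phi)).
Proof.
move=> /D_L1P[dr di].
rewrite [X in T X](_ : phi = fun x => 'i%C * cembed (im phi) x + cembed (re phi) x); last first.
  apply/funext => x; rewrite /cembed /re /im; case: (phi x) => a b.
  by apply/eqP; rewrite eq_complex /=; apply/andP; split; apply/eqP; ring.
rewrite hT.1; [|exact: D_L1_cembed..].
rewrite /Tre /Tim; case: (T _) => a b; case: (T _) => c d.
by apply/eqP; rewrite eq_complex /=; apply/andP; split; apply/eqP; ring.
Qed.

Lemma T_cembed_lin (a : R) p q : rD_L1 p -> rD_L1 q ->
  T (cembed (fun x => a * p x + q x)) = a%:C * T (cembed p) + T (cembed q).
Proof.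
move=> dp dq; rewrite -hT.1; [|exact: D_L1_cembed..].
congr (T _); apply/funext => x; rewrite /cembed.
by apply/eqP; rewrite eq_complex /=; apply/andP; split; apply/eqP; ring.
Qed.

Lemma rlinear_Tre : rlinear Tre.
Proof.
move=> a p q dp dq; rewrite /Tre T_cembed_lin//.
by case: (T _) => b c; case: (T _) => d e /=; ring.
Qed.

Lemma rlinear_Tim : rlinear Tim.
Proof.
move=> a p q dp dq; rewrite /Tim T_cembed_lin//.
by case: (T _) => b c; case: (T _) => d e /=; ring.
Qed.

Lemma rnorm0 m : rnorm m (fun=> 0 : R) = 0.
Proof.
rewrite /rnorm big1// => i _; rewrite /L1.
rewrite (_ : (fun x => _) = fun=> 0) ?Rintegral_cst ?mul0r//.
apply/funext => x; rewrite (@derive1n_outside _ _ (-1)) ?normr0//.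
by rewrite (lt_le_trans _ (normr_ge0 x))// ltrN10.
Qed.

Lemma rnormZ m (a : R) p : rD_L1 p -> rnorm m (fun x => a * p x) <= `|a| * rnorm m p.
Proof.
move=> dp; have := rnorm_lin m a dp rD0; under eq_fun do rewrite addr0.
by rewrite rnorm0 addr0.
Qed.

(** Continuity at the zero function, with tolerance 1, provides a seminorm and a radius [d];
    homogeneity turns this into a bound with constant [1 / d]. *)
Lemma normc_T_bound : exists m, exists2 C : R, 0 <= C &
  forall p, rD_L1 p -> normc (T (cembed p)) <= C * rnorm m p.
Proof.
have T0 : T (cembed (fun=> 0)) = 0.
  have := T_cembed_lin 1 rD0 rD0.
  rewrite (_ : (fun x => _) = fun=> 0); last by apply/funext => x /=; rewrite mulr0 addr0.
  by rewrite mul1r => /eqP; rewrite -subr_eq subrr => /eqP.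
have [m [d d0 H]] := hT.2 _ (D_L1_cembed rD0) 1 ltr01.
have {}H p : rD_L1 p -> rnorm m p < d -> normc (T (cembed p)) < 1.
  move=> dp pd; have := H _ (D_L1_cembed dp); rewrite T0 subr0; apply.
  rewrite -norm_m1_cembed in pd; congr (norm_m1 m _ < d): pd.
  by apply/funext => x; rewrite subr0.
exists m, d^-1 => [|p dp]; first by rewrite invr_ge0 ltW.
apply/ler_addgt0Pr => e e0.
set N := rnorm m p.
have N0 : 0 <= N := rnorm_ge0 m p.
(* The extra [e] puts [p / r] strictly inside the ball of radius [d] and keeps [r] positive even
   when [N = 0]; it is arbitrary, hence disappears from the final bound. *)
pose r := d^-1 * N + e.
have r0 : 0 < r by rewrite ltr_wpDl// mulr_ge0// invr_ge0 ltW.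
have dr : rD_L1 (fun x => r^-1 * p x).
  have := rD_lin r^-1 dp rD0; by under eq_fun do rewrite addr0.
have : normc (T (cembed (fun x => r^-1 * p x))) < 1.
  apply: H => //; apply: le_lt_trans (rnormZ _ _ dp) _.
  rewrite gtr0_norm ?invr_gt0// mulrC ltr_pdivrMr// mulrDr mulrA mulfV ?gt_eqF//.
  by rewrite mul1r ltrDl mulr_gt0.
have := T_cembed_lin r^-1 dp rD0; rewrite T0 addr0.
under eq_fun do rewrite addr0.
move=> ->; rewrite ComplexField.Normc.normcM.
rewrite /= expr0n addr0 sqrtr_sqr gtr0_norm ?invr_gt0//.
by rewrite ltr_pdivrMl// mulr1 => /ltW.
Qed.

Lemma order_le_parts : exists m, order_le m Tre /\ order_le m Tim.
Proof.
have [m [C C0 H]] := normc_T_bound; exists m.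
split; exists C => // p dp; apply: le_trans (H p dp).
  exact: normc_ge_Re.
exact: normc_ge_Im.
Qed.

Lemma convolution_reim phi x : test_function phi ->
  convolution T phi x =
  (Tre (fun y => re phi (x - y)) - Tim (fun y => im phi (x - y))) +i*
  (Tim (fun y => re phi (x - y)) + Tre (fun y => im phi (x - y))).
Proof.
move=> /test_functionP[tr ti]; rewrite /convolution T_reim//.
by apply/D_L1P; split; apply: test_rD; [exact (test_reflect x tr)|exact (test_reflect x ti)].
Qed.

Lemma translates_raa_parts :
  (forall phi, test_function phi -> almost_automorphic (convolution T phi)) <->
  translates_raa Tre /\ translates_raa Tim.
Proof.
split=> [H|[ar ai] phi tphi].
  suff K p : test p -> raa (fun x => Tre (fun y => p (x - y))) /\
      raa (fun x => Tim (fun y => p (x - y))).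
    by split=> p /K[].
  move=> tp; have /almost_automorphicP[] := H _ (test_cembed tp).
  by split.
apply/almost_automorphicP; have [tr ti] := (test_functionP _).1 tphi.
split.
  rewrite (_ : re _ = fun x => -1 * Tim (fun y => im phi (x - y)) +
    Tre (fun y => re phi (x - y))); first by apply: raa_lin; [exact: ai|exact: ar].
  by apply/funext => x; rewrite /re convolution_reim//= mulN1r addrC.
rewrite (_ : im _ = fun x => 1 * Tim (fun y => re phi (x - y)) +
  Tre (fun y => im phi (x - y))); first by apply: raa_lin; [exact: ai|exact: ar].
by apply/funext => x; rewrite /im convolution_reim//= mul1r.
Qed.

End FunctionalParts.

Lemma distribution_derivenE j (S : (R -> R[i]) -> R[i]) phi :
  distribution_deriven j S phi = (-1) ^+ j * S (cderiven j phi).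
Proof.
elim: j phi => [|j IH] phi; first by rewrite expr0 mul1r.
rewrite /distribution_deriven iterS -/(distribution_deriven j S).
rewrite /distribution_derive IH exprS mulN1r mulNr; congr (- (_ * S _)).
by rewrite /cderiven iterSr.
Qed.

Lemma regular_derivenE j f phi : almost_automorphic f -> test_function phi ->
  let I g p := (-1) ^+ j * \int[mu]_x (g x * derive1n j p x) in
  distribution_deriven j (regular_distribution f) phi =
  (I (re f) (re phi) - I (im f) (im phi)) +i* (I (re f) (im phi) + I (im f) (re phi)).
Proof.
move=> /almost_automorphicP[rf jf] /test_functionP[tr ti] I.
have dr := test_derive1n j tr; have di := test_derive1n j ti.
have ii g p := @test_integrable_raa R g p.
rewrite distribution_derivenE /regular_distribution cderivenE /cintegral.
rewrite (_ : (fun x => complex.Re _) = fun x => -1 * (im f x * derive1n j (im phi) x) +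
    re f x * derive1n j (re phi) x); last first.
  by apply/funext => x; rewrite /re /im; case: (f x) => a b /=; ring.
rewrite (_ : (fun x => complex.Im _) = fun x => 1 * (re f x * derive1n j (im phi) x) +
    im f x * derive1n j (re phi) x); last first.
  by apply/funext => x; rewrite /re /im; case: (f x) => a b /=; ring.
rewrite !Rintegral_lin; [|exact: ii..].
rewrite (_ : (-1) ^+ j = ((-1) ^+ j : R)%:C); last by rewrite rmorphXn rmorphN1.
by apply/eqP; rewrite eq_complex /=; apply/andP; split; apply/eqP; rewrite /I; ring.
Qed.

Lemma sum_reim (k : nat) (g : nat -> R[i]) :
  \sum_(j < k) g j = (\sum_(j < k) complex.Re (g j)) +i* (\sum_(j < k) complex.Im (g j)).
Proof.
elim: k => [|k IH]; first by rewrite !big_ord0.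
rewrite !big_ord_recr/= IH; case: (g k) => a b.
by apply/eqP; rewrite eq_complex /=; apply/andP; split; apply/eqP.
Qed.

End ComplexReduction.

Theorem theorem1 (R : realType) (T : (R -> R[i]) -> R[i])
    (hT : bounded_distribution T) :
  (forall phi : R -> R[i], test_function phi ->
     almost_automorphic (convolution T phi))
  <->
  (exists (k : nat) (f : 'I_k.+1 -> R -> R[i]),
     (forall j : 'I_k.+1, almost_automorphic (f j)) /\
     eq_distribution T
       (fun phi => \sum_(j < k.+1)
          distribution_deriven j (regular_distribution (f j)) phi)).
Proof.
have lr := rlinear_Tre hT; have li := rlinear_Tim hT.
have DT (phi : R -> R[i]) : test_function phi -> D_L1 phi.
  by move=> /test_functionP[tr ti]; apply/D_L1P; split; exact: test_rD.
rewrite (translates_raa_parts hT).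
split=> [[ar ai]|[k [f [rf Tf]]]].
  (* A common order for both parts gives two representations of the same length, which combine term
     by term into complex functions. *)
  have [m [or oi]] := order_le_parts hT.
  have [f rf hf] := representation lr or ar.
  have [g rg hg] := representation li oi ai.
  pose F (j : nat) x := f j x +i* g j x.
  have aF j : almost_automorphic (F j).
    by apply/almost_automorphicP; split; [exact: (rf j)|exact: (rg j)].
  exists m.+1, (fun j => F j); split=> // phi tphi.
  have [tr ti] := (test_functionP _).1 tphi.
  rewrite (T_reim hT (DT _ tphi)) (hf _ tr) (hf _ ti) (hg _ tr) (hg _ ti).
  rewrite -sumrB -big_split/= (@sum_reim R m.+2
    (fun j => distribution_deriven j (regular_distribution (F j)) phi)).
  congr (_ +i* _); apply: eq_bigr => j _; rewrite regular_derivenE//=.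
  by rewrite addrC.
(* The real lemmas take families indexed by [nat]; the given one is extended by the zero function,
   which is almost automorphic. *)
pose F (j : nat) := if insub j is Some i then f i else fun=> 0.
have Ff (j : 'I_k.+1) : F j = f j by rewrite /F valK.
have aF j : almost_automorphic (F j).
  rewrite /F; case: insub => [i|]; first exact: rf.
  by apply/almost_automorphicP; split; exact: raa0.
have im0 (g p : R -> R) j : \int[@lebesgue_measure R]_x (g x * derive1n j (im (cembed p)) x) = 0.
  rewrite (_ : (fun x => _) = fun=> 0) ?Rintegral_cst ?mul0r//.
  apply/funext => x; rewrite (@derive1n_outside _ _ (-1)) ?mulr0//.
  by rewrite (lt_le_trans _ (normr_ge0 x))// ltrN10.
have HT p : test p -> T (cembed p) =
    (\sum_(j < k.+1) (-1) ^+ j * \int[@lebesgue_measure R]_x (re (F j) x * derive1n j p x)) +i*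
    (\sum_(j < k.+1) (-1) ^+ j * \int[@lebesgue_measure R]_x (im (F j) x * derive1n j p x)).
  move=> tp; rewrite (Tf _ (test_cembed tp)).
  under eq_bigr do rewrite -Ff.
  rewrite (@sum_reim R k.+1
    (fun j => distribution_deriven j (regular_distribution (F j)) (cembed p))).
  by congr (_ +i* _); apply: eq_bigr => j _;
    rewrite (regular_derivenE j (aF j) (test_cembed tp))/= im0 mulr0 ?subr0 ?add0r.
split.
  apply: (@representable_translates R _ k (fun j => re (F j))).
    by move=> j; case/almost_automorphicP: (aF j).
  by move=> p tp; rewrite /Tre HT.
apply: (@representable_translates R _ k (fun j => im (F j))).
  by move=> j; case/almost_automorphicP: (aF j).
by move=> p tp; rewrite /Tim HT.
Qed.
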